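(* Let $G$ be a graph on $n\ge 8$ vertices with at least $4.5n-12$ edges. Then $G$ has a $\mathcal{K}_8^{-4}$ minor, i.e. some graph obtained from $K_8$ by deleting four edges is a minor of $G$.
   Context: All graphs are finite and simple. A graph $H$ is a minor of a graph $G$ if $H$ can be obtained from a subgraph of $G$ by contracting edges. For positive integers $t,s$, $\mathcal{K}_t^{-s}$ denotes the family of all graphs obtained from the complete graph $K_t$ by deleting $s$ edges; $G$ has a $\mathcal{K}_t^{-s}$ minor if it has an $H$ minor for some $H\in\mathcal{K}_t^{-s}$. *)

(* Defs.v *)
From mathcomp Require Import all_boot all_order all_algebra.
Set Implicit Arguments.
Unset Strict Implicit.
Unset Printing Implicit Defensive.

Record sgraph := SGraph {
  svertex :> finType;
  sedge : rel svertex;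
  sedge_sym : symmetric sedge;
  sedge_irr : irreflexive sedge
}.

Notation "x -- y" := (sedge x y) (at level 30).

Definition edges (G : sgraph) : {set {set G}} :=
  [set [set p.1; p.2] | p : G * G & p.1 -- p.2].

Definition isomorphic (G H : sgraph) : Prop :=
  exists2 f : G -> H, bijective f & {mono f : x y / x -- y}.

(* Subgraphs are taken up to isomorphism: S is a copy of a subgraph of G,
   not necessarily induced or spanning, embedded by f. *)
Definition subgraph (S G : sgraph) : Prop :=
  exists2 f : S -> G, injective f & {homo f : x y / x -- y}.

Section Contraction.
Variables (G : sgraph) (x y : G).

(* The vertex y is merged into x: what remains is G without y, where x has
   inherited the neighbours of y; loops and parallel edges disappear. *)
Definition contract_rel : rel {z : G | z != y} := fun a b =>
  (a != b) &&
  [|| val a -- val b, (val a == x) && (y -- val b)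
    | (val b == x) && (y -- val a)].

Lemma contract_sym : symmetric contract_rel.
Proof.
move=> a b; rewrite /contract_rel eq_sym sedge_sym.
by congr (_ && (_ || _)); rewrite orbC.
Qed.

Lemma contract_irr : irreflexive contract_rel.
Proof. by move=> a; rewrite /contract_rel eqxx. Qed.

(* Only meaningful as an edge contraction when x -- y. *)
Definition contract : sgraph := SGraph contract_sym contract_irr.

End Contraction.

Inductive contracts_to (G H : sgraph) : Prop :=
| ContractDone of isomorphic G H
| ContractEdge (x y : G) of x -- y & contracts_to (contract x y) H.

Definition minor (H G : sgraph) : Prop :=
  exists2 S : sgraph, subgraph S G & contracts_to S H.

Section DeleteEdges.
Variables (G : sgraph) (F : {set {set G}}).

Definition del_rel : rel G := fun x y => (x -- y) && ([set x; y] \notin F).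

Lemma del_sym : symmetric del_rel.
Proof. by move=> x y; rewrite /del_rel sedge_sym setUC. Qed.

Lemma del_irr : irreflexive del_rel.
Proof. by move=> x; rewrite /del_rel sedge_irr. Qed.

Definition del_edges : sgraph := SGraph del_sym del_irr.

End DeleteEdges.

Section Complete.
Variable t : nat.

Definition complete_rel : rel 'I_t := fun i j => i != j.

Lemma complete_sym : symmetric complete_rel.
Proof. by move=> i j; rewrite /complete_rel eq_sym. Qed.

Lemma complete_irr : irreflexive complete_rel.
Proof. by move=> i; rewrite /complete_rel eqxx. Qed.

Definition complete : sgraph := SGraph complete_sym complete_irr.

End Complete.

Definition complete_minus (t s : nat) (H : sgraph) : Prop :=
  exists F : {set {set complete t}},
    [/\ F \subset edges (complete t), #|F| = s & isomorphic H (del_edges F)].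

Definition has_complete_minus_minor (t s : nat) (G : sgraph) : Prop :=
  exists2 H : sgraph, complete_minus t s H & minor H G.

(* Main.v *)
(* Idea.  Write ds for twice the number of edges.  In a minimal counterexample G
   on n vertices, 9n - 24 <= ds <= 9n - 23 and every proper minor with n' >= 8
   vertices has ds <= 9n' - 25.  Hence every edge lies in at least 4 triangles,
   the minimum degree is at least 5, and some vertex has degree at most 8.

   If y has degree 5 then N(y) is a clique A, ds = 9n - 24, and any two vertices
   of A have a common neighbour outside N[y] (delete y, then contract the edge
   between them).  Counting over a separation whose separator can be made a
   clique of size at most 4 gives a contradiction, so G - N[y] is connected and
   sees all of A.  Splitting G - N[y] into two connected parts must leave one of
   them with at most 2 neighbours in A; a maximal such part produces a
   separator of size at most 3, again a contradiction.

   If the minimum degree is at least 6, take x of degree at most 8 and a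
   component C of G - N[x] with |C| minimal.  Counting edges in C and its
   neighbourhood gives a vertex of C of degree at most 8; let z be one of least
   degree, and D the component of G - N[z] containing x.  By minimality of C,
   every vertex of N(z) with no neighbour in D has the same closed neighbourhood
   as z.  So N[z] together with D, contracted to a vertex or into a vertex of
   N(z), yields the minor when z has degree 7 or 8; when z has degree 6, either
   this works or N(z) contains a separator of size at most 4 to which minimality
   applies. *)

Require Import Defs.
From Stdlib Require Import Classical.
From mathcomp Require Import all_boot all_order all_algebra zify lra.
Set Implicit Arguments.
Unset Strict Implicit.
Unset Printing Implicit Defensive.

(* [lia] preprocesses every boolean hypothesis in sight, which is prohibitive in
   contexts full of set memberships, so only arithmetic hypotheses are kept. *)
Ltac nlia :=
  intros;
  repeat match goal with H : ?P |- _ =>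
    lazymatch type of P with Prop =>
      lazymatch P with
      | is_true (leq _ _) => fail
      | @eq nat _ _ => fail
      | odd _ = false => fail
      | is_true (leq _ _) -> is_true (leq _ _) => fail
      | is_true (leq _ _) -> is_true (leq _ _) -> is_true (leq _ _) => fail
      | @eq nat _ _ -> is_true (leq _ _) => fail
      | _ => clear H
      end
    end
  end; lia.

(** * Connected sets and minors as branch sets *)

(** Phrased with closed subsets rather than paths, so that connectedness serves directly as an
    induction principle ([conn_sub]). The empty set is excluded because branch sets are nonempty. *)
Definition conn (G : sgraph) (X : {set G}) : Prop :=
  X != set0 /\
  forall Y : {set G}, Y \subset X -> Y != set0 ->
    (forall x y, x \in Y -> y \in X -> x -- y -> y \in Y) -> Y = X.

(** Not the open neighbourhood: a vertex of [X] with a neighbour in [X] belongs to it as well. *)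
Definition nbs (G : sgraph) (X : {set G}) : {set G} :=
  [set y | [exists x in X, x -- y]].

Definition nb (G : sgraph) (x : G) : {set G} := [set y | x -- y].

Lemma nbsP (G : sgraph) (X : {set G}) y :
  reflect (exists2 x, x \in X & x -- y) (y \in nbs X).
Proof. by rewrite inE; apply: (iffP exists_inP). Qed.

Lemma conn_sub (G : sgraph) (X Z : {set G}) x0 :
  conn X -> (forall x y, x \in Z -> x \in X -> y \in X -> x -- y -> y \in Z) ->
  x0 \in X -> x0 \in Z -> X \subset Z.
Proof.
move=> [_ cX] clZ x0X x0Z; rewrite -(cX (Z :&: X)) ?subsetIl ?subsetIr //.
  by apply/set0Pn; exists x0; rewrite inE x0Z.
move=> x y /setIP[xZ xX] yX xy; rewrite inE yX andbT.
exact: clZ xy.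
Qed.

Lemma conn1 (G : sgraph) (x : G) : conn [set x].
Proof.
split=> [|Y]; first by apply/set0Pn; exists x; rewrite inE.
by rewrite subset1 => /orP[/eqP->|/eqP->] //; rewrite eqxx.
Qed.

Lemma connU (G : sgraph) (X Y : {set G}) x y :
  conn X -> conn Y -> x \in X -> y \in Y -> (x == y) || x -- y ->
  conn (X :|: Y).
Proof.
move=> cX cY xX yY xy; split.
  by apply/set0Pn; exists x; rewrite inE xX.
move=> Z ZXY /set0Pn[z zZ] clZ.
have clX : forall x y, x \in Z -> x \in X -> y \in X -> x -- y -> y \in Z.
  by move=> a b aZ _ bX; apply: clZ => //; rewrite inE bX.
have clY : forall x y, x \in Z -> x \in Y -> y \in Y -> x -- y -> y \in Z.
  by move=> a b aZ _ bX; apply: clZ => //; rewrite inE bX orbT.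
have xyZ : (x \in Z) = (y \in Z).
  case/orP: xy => [/eqP->//|xy]; apply/idP/idP => [xZ|yZ].
    by apply: clZ xy => //; rewrite inE yY orbT.
  by apply: (clZ y) => //; rewrite ?inE ?xX // sedge_sym.
suff [XZ YZ] : X \subset Z /\ Y \subset Z.
  by apply/eqP; rewrite eqEsubset ZXY subUset XZ YZ.
have /setUP[zX|zY] := subsetP ZXY _ zZ.
  have XZ := conn_sub cX clX zX zZ; split=> //.
  by apply: (conn_sub cY clY yY); rewrite -xyZ (subsetP XZ).
have YZ := conn_sub cY clY zY zZ; split=> //.
by apply: (conn_sub cX clX xX); rewrite xyZ (subsetP YZ).
Qed.

(** Both ends of each step lie in [X], so for [x] outside [X] the value is the singleton of [x]. *)
Definition component (G : sgraph) (X : {set G}) (x : G) : {set G} :=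
  [set y | connect [rel a b | [&& a \in X, b \in X & a -- b]] x y].

Lemma component_self (G : sgraph) (X : {set G}) x : x \in component X x.
Proof. by rewrite inE connect0. Qed.

Lemma component_closed (G : sgraph) (X : {set G}) x y z :
  y \in component X x -> y \in X -> z \in X -> y -- z -> z \in component X x.
Proof.
rewrite !inE => xy yX zX yz; apply: connect_trans xy (connect1 _).
by rewrite /= yX zX.
Qed.

Lemma component_sub (G : sgraph) (X : {set G}) x : x \in X -> component X x \subset X.
Proof.
move=> xX; apply/subsetP => y; rewrite inE => /connectP[p].
elim/last_ind: p => [_ -> //|p z _]; rewrite rcons_path last_rcons => /andP[_].
by case/and3P => _ zX _ ->.
Qed.

Lemma component_conn (G : sgraph) (X : {set G}) x : conn (component X x).
Proof.
split; first by apply/set0Pn; exists x; apply: component_self.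
move=> Y Ysub /set0Pn[y yY] clY; apply/eqP; rewrite eqEsubset Ysub /=.
set e := [rel a b | [&& a \in X, b \in X & a -- b]].
have esym : connect_sym e.
  apply: sym_connect_sym => a b /=.
  by rewrite sedge_sym andbCA.
have clYe : closed e (mem Y).
  apply: (intro_closed esym) => a b /= eab aY.
  have ab : a -- b by case/and3P: eab.
  apply: clY ab => //; rewrite inE; apply: (@connect_trans _ e a); last exact: connect1.
  by have := subsetP Ysub _ aY; rewrite inE.
apply/subsetP => z; rewrite inE -/e => xz.
have := subsetP Ysub _ yY; rewrite inE -/e => xy.
have yz : connect e y z by rewrite esym in xy; apply: connect_trans xy xz.
by rewrite -(closed_connect clYe yz).
Qed.

Lemma component_nbs (G : sgraph) (X : {set G}) x y :
  x \in X -> y \in nbs (component X x) -> y \in component X x \/ y \notin X.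
Proof.
move=> xX /nbsP[z zC zy]; case: (boolP (y \in X)) => yX; last by right.
left; apply: component_closed zy => //; exact: (subsetP (component_sub xX)).
Qed.

Definition model (H G : sgraph) (B : H -> {set G}) : Prop :=
  [/\ forall u, conn (B u),
      forall u v, u != v -> [disjoint B u & B v]
    & forall u v, u -- v -> exists2 x, x \in B u & x \in nbs (B v)].

Definition gminor (H G : sgraph) : Prop := exists B : H -> {set G}, model B.

(** The vertices of [X] whose branch sets lie inside a closed subset [Y] form a closed subset of
    [X], because adjacent vertices have branch sets joined by an edge. *)
Lemma conn_bigcup (H G : sgraph) (B : H -> {set G}) (X : {set H}) :
  model B -> conn X -> conn (\bigcup_(u in X) B u).
Proof.
move=> [cB dB eB] cX; split.
  have [/set0Pn[u uX] _] := cX; have [/set0Pn[x xu] _] := cB u.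
  by apply/set0Pn; exists x; apply/bigcupP; exists u.
move=> Y Ysub /set0Pn[y yY] clY; apply/eqP; rewrite eqEsubset Ysub /=.
have memY u x : u \in X -> x \in B u -> x \in Y -> B u \subset Y.
  move=> uX xu xY; apply: (conn_sub (cB u)) xu xY => a b aY _ bu.
  by apply: clY => //; apply/bigcupP; exists u.
have /bigcupP[u uX yu] := subsetP Ysub _ yY.
have XZ : X \subset [set v in X | B v \subset Y].
  apply: (conn_sub cX _ uX); last by rewrite inE uX (memY _ y).
  move=> v w; rewrite !inE => /andP[_ vY] vX wX /eB[x xv /nbsP[z zw zx]].
  rewrite wX (memY _ z) //; apply: (clY x); rewrite ?(subsetP vY) //.
    by apply/bigcupP; exists w.
  by rewrite sedge_sym.
apply/bigcupsP => v vX; have := subsetP XZ _ vX; by rewrite inE vX.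
Qed.

Lemma gminor_trans (K H G : sgraph) : gminor K H -> gminor H G -> gminor K G.
Proof.
move=> [B [cB dB eB]] [C mC]; have [cC dC eC] := mC.
exists (fun u => \bigcup_(v in B u) C v); split.
- by move=> u; apply: conn_bigcup.
- move=> u v uv; rewrite -setI_eq0; apply/eqP/setP => x; rewrite !inE.
  apply/andP => -[/bigcupP[a au xa] /bigcupP[b bv xb]].
  have := dB _ _ uv => /disjoint_setI0 /setP duv.
  have ab : a != b by apply: contraTneq au => ->; have := duv b; rewrite !inE bv andbT => ->.
  have /disjoint_setI0 /setP /(_ x) := dC _ _ ab.
  by rewrite !inE xa xb.
- move=> u v /eB[a au /nbsP[b bv ba]].
  have [y yb /nbsP[x xa xy]] := eC _ _ ba.
  exists x; first by apply/bigcupP; exists a.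
  by apply/nbsP; exists y; [apply/bigcupP; exists b | rewrite sedge_sym].
Qed.

(** Induction on the order of [S]. If [f] is not injective, some connected fibre has at least two
    vertices and hence contains an edge; contracting that edge preserves the three hypotheses. *)
Lemma contracts_to_fibers (S H : sgraph) (f : S -> H) :
  (forall u, conn [set x | f x == u]) ->
  (forall x y, x -- y -> f x != f y -> f x -- f y) ->
  (forall u v, u -- v -> exists x y, [/\ f x = u, f y = v & x -- y]) ->
  contracts_to S H.
Proof.
have [n] := ubnP #|S|; elim: n S f => // n IHn S f ltSn cf hf ef.
case: (boolP (injectiveb f)) => [/injectiveP injf|/injectivePn[x0 [y0 xy0 fxy0]]].
  apply: ContractDone; exists f.
    have surj u : exists x, f x == u.
      by have [/set0Pn[x]] := cf u; rewrite inE => fx _; exists x.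
    exists (fun u => xchoose (surj u)) => [x|u]; last by apply/eqP; apply: (xchooseP (surj u)).
    by apply: injf; apply/eqP; apply: (xchooseP (surj (f x))).
  move=> x y; apply/idP/idP => [/ef[a [b [/injf-> /injf-> //]]]|xy].
  apply: hf => //; apply: contraTneq xy => /injf ->; by rewrite sedge_irr.
have [x [y [xy fxy]]] : exists x y, x -- y /\ f x = f y.
  case: (boolP [exists x, [exists y, (x -- y) && (f x == f y)]]).
    by move=> /existsP[x /existsP[y /andP[xy /eqP]]]; exists x, y.
  (* Without an edge inside a fibre, the singleton of [x0] is closed in its fibre and so equals it,
     although [y0] lies there too. *)
  move=> /existsPn noe; case/eqP: xy0.
  have [_ c] := cf (f x0).
  have /setP/(_ y0) : [set x0] = [set x | f x == f x0].
    apply: c; first by rewrite sub1set inE.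
      by apply/set0Pn; exists x0; rewrite inE.
    move=> a b; rewrite !inE => /eqP-> fb ab.
    by have /existsPn/(_ b) := noe x0; rewrite ab eq_sym fb.
  by rewrite !inE fxy0 eqxx => /eqP.
have xNy : x != y by apply: contraTneq xy => ->; rewrite sedge_irr.
apply: (ContractEdge xy).
pose sx : contract x y := Sub x xNy.
(* The default [sx] is taken only at [y], so [proj] is the quotient map sending [y] to [x]. *)
pose proj (z : S) : contract x y := insubd sx z.
have vproj z : val (proj z) = if z == y then x else z.
  by rewrite val_insubd /=; case: (z == y).
have fproj z : f (val (proj z)) = f z by rewrite vproj; case: eqP => // ->.
have projK a : proj (val a) = a by apply: valKd.
have eproj z w : z -- w -> proj z != proj w -> proj z -- proj w.
  move=> zw pzw; rewrite /= /contract_rel pzw /= !vproj.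
  case: eqP => [zy|_]; case: eqP => [wy|_]; rewrite ?zw ?eqxx //=.
  - by move: zw; rewrite zy wy sedge_irr.
  - by rewrite -zy zw orbT.
  - by rewrite -wy [w -- z]sedge_sym zw !orbT.
apply: (IHn (contract x y) (fun z => f (val z))).
- rewrite /= card_sig (eq_card (B := predC1 y)) // cardC1.
  have : 0 < #|S| by apply/card_gt0P; exists y.
  by move: ltSn; lia.
- move=> u; have [/set0Pn[z0 z0u] c] := cf u; rewrite inE in z0u; split.
    by apply/set0Pn; exists (proj z0); rewrite inE fproj.
  move=> Y Ysub /set0Pn[b bY] clY.
  have YE : [set z | proj z \in Y] = [set z | f z == u].
    apply: c.
    - by apply/subsetP => z; rewrite inE => /(subsetP Ysub); rewrite !inE fproj.
    - by apply/set0Pn; exists (val b); rewrite inE projK.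
    move=> z w; rewrite !inE => zY fw zw.
    case: (eqVneq (proj z) (proj w)) => [<-//|pzw].
    by apply: clY (eproj _ _ zw pzw) => //; rewrite inE fproj.
  apply/setP => a; move/setP: YE => /(_ (val a)).
  by rewrite !inE projK.
- move=> a b /andP[_ /or3P[ab|/andP[/eqP ax yb]|/andP[/eqP bx ya]]].
  + exact: hf.
  + by rewrite ax fxy; apply: hf.
  + by rewrite bx fxy eq_sym => fn; rewrite sedge_sym; apply: hf.
- move=> u v uv; have [a [b [fa fb ab]]] := ef u v uv.
  exists (proj a), (proj b); rewrite !fproj; split=> //; apply: eproj => //.
  apply: contraTneq uv => pab.
  by rewrite -fa -fb -fproj pab fproj sedge_irr.
Qed.

(** The subgraph lives on the union of the branch sets and drops every edge between branch sets of
    distinct non-adjacent vertices of [H]. The branch sets are then the fibres of a map onto [H]. *)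
Lemma gminor_minor (H G : sgraph) : gminor H G -> minor H G.
Proof.
move=> [B [cB dB eB]].
pose T := {x : G | [exists u, x \in B u]}.
pose f (x : T) : H := xchoose (existsP (valP x)).
have fB (x : T) : val x \in B (f x) by apply: (xchooseP (existsP (valP x))).
have memB (x : T) u : val x \in B u -> f x = u.
  move=> xu; apply/eqP; apply: contraT => /dB/disjoint_setI0/setP/(_ (val x)).
  by rewrite !inE fB xu.
pose e : rel T := fun x y => (val x -- val y) && ((f x == f y) || (f x -- f y)).
have esym : symmetric e.
  by move=> x y; rewrite /e sedge_sym eq_sym [f x -- _]sedge_sym.
have eirr : irreflexive e by move=> x; rewrite /e sedge_irr.
exists (SGraph esym eirr).
  by exists val => [|x y /andP[]//]; apply: val_inj.
have lift x u : x \in B u -> exists2 x' : T, val x' = x & f x' = u.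
  move=> xu; have xT : [exists u, x \in B u] by apply/existsP; exists u.
  by exists (Sub x xT) => //; apply: memB.
apply: (@contracts_to_fibers (SGraph esym eirr) H f).
- move=> u; have [/set0Pn[x xu] c] := cB u; split.
    by have [x' _ <-] := lift _ _ xu; apply/set0Pn; exists x'; rewrite inE.
  move=> Y Ysub /set0Pn[y yY] clY.
  have YE : val @: Y = B u.
    apply: c.
    - apply/subsetP => z /imsetP[w wY ->].
      by move/(subsetP Ysub): wY; rewrite inE => /eqP<-.
    - by apply/set0Pn; exists (val y); apply: imset_f.
    move=> a b /imsetP[a' a'Y ->] bu ab.
    have [b' b'E fb'] := lift _ _ bu.
    rewrite -b'E; apply: imset_f; apply: (clY a') => //; first by rewrite inE fb'.
    rewrite /= /e b'E ab fb' /=.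
    by move/(subsetP Ysub): a'Y; rewrite inE => ->.
  apply/setP => a; rewrite inE; apply/idP/eqP => [/(subsetP Ysub)|fa].
    by rewrite inE => /eqP.
  have : val a \in val @: Y by rewrite YE -fa.
  by case/imsetP => a' a'Y /val_inj ->.
- by move=> x y /andP[_ /orP[->|]].
- move=> u v uv; have [x xu /nbsP[y yv yx]] := eB _ _ uv.
  have [x' x'E fx] := lift _ _ xu; have [y' y'E fy] := lift _ _ yv.
  exists x', y'; split=> //.
  by rewrite /= /e x'E y'E fx fy uv orbT andbT sedge_sym.
Qed.

(** * Degree sums *)

(* Twice the number of edges of the subgraph induced by W. *)
Definition dsum (G : sgraph) (W : {set G}) : nat := \sum_(x in W) #|nb x :&: W|.

(** For disjoint sets this is the number of edges between them, while [cross A A] is [dsum A]. *)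
Definition cross (G : sgraph) (K V : {set G}) : nat := \sum_(x in K) #|nb x :&: V|.

Lemma card_setI_sum (T : finType) (A B : {set T}) :
  #|A :&: B| = \sum_(y in B) (y \in A : nat).
Proof.
rewrite -sum1_card big_mkcond [RHS]big_mkcond; apply: eq_bigr => y _.
by rewrite inE; case: (y \in A); case: (y \in B).
Qed.

Lemma card_nbI (G : sgraph) (x : G) W : #|nb x :&: W| = \sum_(y in W) (x -- y : nat).
Proof. by rewrite card_setI_sum; apply: eq_bigr => y _; rewrite inE. Qed.

Lemma e2C (G : sgraph) (K V : {set G}) : cross K V = cross V K.
Proof.
rewrite /cross (eq_bigr _ (fun x _ => card_nbI x V)) exchange_big.
by apply: eq_bigr => y _; rewrite card_nbI; apply: eq_bigr => x _; rewrite sedge_sym.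
Qed.

Lemma big_setU_disj (T : finType) (A B : {set T}) (F : T -> nat) :
  [disjoint A & B] -> \sum_(x in A :|: B) F x = \sum_(x in A) F x + \sum_(x in B) F x.
Proof. by move=> dAB; rewrite -bigU //; apply: eq_bigl => x; rewrite !inE. Qed.

Lemma card_setIU_disj (T : finType) (C A B : {set T}) :
  [disjoint A & B] -> #|C :&: (A :|: B)| = #|C :&: A| + #|C :&: B|.
Proof. by move=> dAB; rewrite !card_setI_sum big_setU_disj. Qed.

Lemma e2Ur (G : sgraph) (K A B : {set G}) : [disjoint A & B] ->
  cross K (A :|: B) = cross K A + cross K B.
Proof.
by move=> dAB; rewrite /cross -big_split; apply: eq_bigr => x _; rewrite card_setIU_disj.
Qed.

Lemma dsumU (G : sgraph) (A B : {set G}) : [disjoint A & B] ->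
  dsum (A :|: B) = dsum A + dsum B + (cross A B).*2.
Proof.
move=> dAB; rewrite {1}/dsum big_setU_disj //.
rewrite -[X in X + _]/(cross A (A :|: B)) -[X in _ + X]/(cross B (A :|: B)).
by rewrite !e2Ur // (e2C B A) -[cross A A]/(dsum A) -[cross B B]/(dsum B); lia.
Qed.

Lemma dsum1 (G : sgraph) (v : G) : dsum [set v] = 0.
Proof.
rewrite /dsum big_set1; apply/eqP; rewrite cards_eq0 setI_eq0 disjoint_sym.
by rewrite disjoints1 inE sedge_irr.
Qed.

Lemma dsumD1 (G : sgraph) (W : {set G}) v : v \in W ->
  dsum W = dsum (W :\ v) + (#|nb v :&: W|).*2.
Proof.
move=> vW; have dv : [disjoint [set v] & W :\ v] by rewrite disjoints1 !inE eqxx.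
rewrite -{1}(setD1K vW) dsumU // dsum1 add0n; congr (_ + _.*2).
rewrite /cross big_set1; apply: eq_card => y; rewrite !inE.
by case: eqP => // ->; rewrite sedge_irr.
Qed.

(** Vertices are removed one at a time. Parity serves below to sharpen integer bounds by one. *)
Lemma dsum_even (G : sgraph) (W : {set G}) : odd (dsum W) = false.
Proof.
have [n] := ubnP #|W|; elim: n W => // n IHn W ltWn.
have [->|[v vW]] := set_0Vmem W; first by rewrite /dsum big_set0.
rewrite (dsumD1 vW) oddD odd_double IHn //.
by move: ltWn; rewrite (cardsD1 v) vW; lia.
Qed.

Lemma nbI_le (G : sgraph) (W : {set G}) x : x \in W -> #|nb x :&: W| <= #|W|.-1.
Proof.
move=> xW; have -> : #|W|.-1 = #|W :\ x| by rewrite (cardsD1 x W) xW.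
apply: subset_leq_card; apply/subsetP => y; rewrite !inE => /andP[xy ->].
by rewrite andbT; apply: contraTneq xy => ->; rewrite sedge_irr.
Qed.

Lemma dsum_le (G : sgraph) (W : {set G}) : dsum W <= #|W| * #|W|.-1.
Proof.
by rewrite -sum_nat_const; apply: leq_sum => x xW; apply: nbI_le.
Qed.

Lemma dsum_clique (G : sgraph) (W : {set G}) :
  (forall x y, x \in W -> y \in W -> x != y -> x -- y) ->
  dsum W = #|W| * #|W|.-1.
Proof.
move=> cW; rewrite -sum_nat_const; apply: eq_bigr => x xW.
have -> : #|W|.-1 = #|W :\ x| by rewrite (cardsD1 x W) xW.
apply: eq_card => y; rewrite !inE.
case: (boolP (y \in W)) => yW; rewrite ?andbF ?andbT //.
case: eqVneq => [->|nyx]; first by rewrite sedge_irr.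
by rewrite cW // eq_sym.
Qed.

(** Each member of [edges G] is the image of at least two ordered adjacent pairs, its two
    orientations. *)
Lemma edges_dsum (G : sgraph) : #|edges G|.*2 <= dsum [set: G].
Proof.
pose P := [set p : G * G | p.1 -- p.2].
pose h (p : G * G) := [set p.1; p.2].
have -> : edges G = h @: P by rewrite /edges; apply: eq_imset => // p; rewrite inE.
have -> : dsum [set: G] = #|P|.
  rewrite /dsum -sum1_card (eq_bigr (fun x => \sum_(y | x -- y) 1)).
    rewrite pair_big_dep /=; apply: eq_bigl => p; by rewrite !inE.
  by move=> x _; rewrite -sum1_card; apply: eq_bigl => y; rewrite !inE andbT.
rewrite -[#|P|]sum1_card (partition_big_imset h) /= -muln2.
rewrite -sum_nat_const; apply: leq_sum => E /imsetP[p pP ->].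
rewrite sum1dep_card.
have pne : p != (p.2, p.1).
  apply: contraTneq pP => pE; rewrite inE {1}pE /=.
  by case: p pE => a b /= [-> _]; rewrite sedge_irr.
apply: leq_trans (_ : #|[set p; (p.2, p.1)]| <= _); first by rewrite cards2 pne.
apply: subset_leq_card; apply/subsetP => q /set2P[]->; rewrite inE.
  by rewrite pP /=.
by move: pP; rewrite !inE /h /= sedge_sym => ->; rewrite setUC /=.
Qed.

(** * Dense minors on eight vertices *)

Definition dense8_minor (G : sgraph) : Prop :=
  exists H : sgraph, [/\ #|H| = 8, 48 <= dsum [set: H] & gminor H G].

Lemma dense8_minor_trans (H G : sgraph) : gminor H G -> dense8_minor H -> dense8_minor G.
Proof. by move=> HG [K [cK dK KH]]; exists K; split=> //; apply: gminor_trans HG. Qed.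

Lemma set_between (T : finType) (A B : {set T}) k :
  A \subset B -> #|A| <= k -> k <= #|B| ->
  exists F : {set T}, [/\ A \subset F, F \subset B & #|F| = k].
Proof.
move=> AB; elim: k => [|m IHm].
  rewrite leqn0 cards_eq0 => /eqP-> _; exists set0.
  by rewrite subxx sub0set cards0.
rewrite leq_eqVlt => /orP[/eqP Am|Am] mB; first by exists A.
have [F [AF FB Fm]] := IHm Am (ltnW mB).
have /set0Pn[x] : B :\: F != set0.
  by rewrite -card_gt0 cardsD (setIidPr FB) Fm subn_gt0.
rewrite inE => /andP[xF xB]; exists (x |: F); split.
- exact: subset_trans AF (subsetUr _ _).
- by rewrite subUset sub1set xB.
- by rewrite cardsU1 xF Fm.
Qed.

Lemma dsum_setT (G : sgraph) : dsum [set: G] = \sum_(x : G) #|nb x|.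
Proof. by apply: eq_big => [x|x _]; rewrite ?inE // setIT. Qed.

(** At every vertex of [H] the neighbours and non-neighbours number at most 7 together, so 56 - 48
    leaves at most four non-adjacent pairs. These are padded to exactly four edges of the complete
    graph, and deleting the padded set leaves a subgraph of [H]. *)
Lemma dense8_has_complete_minus_minor (G : sgraph) : dense8_minor G -> has_complete_minus_minor 8 4 G.
Proof.
move=> [H [cH dH HG]].
pose g (i : 'I_8) : H := enum_val (cast_ord (esym cH) i).
have gI : injective g by move=> i j /enum_val_inj/cast_ord_inj.
pose m : rel 'I_8 := fun i j => (i != j) && ~~ (g i -- g j).
have msym : symmetric m by move=> i j; rewrite /m eq_sym sedge_sym.
have mirr : irreflexive m by move=> i; rewrite /m eqxx.
pose M := SGraph msym mirr; pose K := complete 8.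
have dK : dsum [set: K] = 56.
  by rewrite dsum_clique ?cardsT ?card_ord // => x y _ _ xy.
(* The star at [o 0] already supplies four edges, which leaves room for the padding. *)
have cEK : 4 <= #|edges K|.
  pose o k : K := inord k.
  have on (i j : nat) : i < 8 -> j < 8 -> i != j -> o i -- o j.
    by move=> i8 j8 ij; rewrite /= /complete_rel -val_eqE /= !inordK.
  have inE2 i j : i < 8 -> j < 8 -> i != j -> [set o i; o j] \in edges K.
    by move=> *; apply/imsetP; exists (o i, o j); rewrite ?inE ?on.
  have injf : injective (fun i : 'I_4 => [set o 0; o i.+1]).
    move=> i j; have i4 := ltn_ord i; have j4 := ltn_ord j.
    move/setP/(_ (o i.+1)); rewrite !inE eqxx orbT => /esym/orP[]/eqP/(congr1 val).
    1,2: rewrite /= !inordK; try lia.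
    by case=> ij; apply: val_inj.
  rewrite -[4]card_ord -(card_imset _ injf); apply: subset_leq_card.
  by apply/subsetP => E /imsetP[i _ ->]; apply: inE2 => //; have := ltn_ord i; lia.
have MK : edges M \subset edges K.
  apply/subsetP => E /imsetP[p]; rewrite inE => /andP[pq _] ->.
  by apply/imsetP; exists p; rewrite ?inE.
have cM : #|edges M| <= 4.
  have := edges_dsum M.
  suff : dsum [set: H] + dsum [set: M] <= 56 by lia.
  have gbij : bijective g by apply: inj_card_bij; rewrite // cH card_ord.
  rewrite !dsum_setT (reindex g) /=; last exact: onW_bij.
  rewrite -big_split (_ : 56 = \sum_(i < 8) 7) /=; last by rewrite sum_nat_const card_ord.
  apply: leq_sum => i _.
  rewrite -[#|nb (g i)|](on_card_preimset (f := g)); last exact: onW_bij.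
  have dij : [disjoint g @^-1: nb (g i) & nb (i : M)].
    rewrite -setI_eq0; apply/eqP/setP => j; rewrite !inE /= /m.
    by case: (g i -- g j); rewrite ?andbF.
  have c7 : #|[set~ i]| = 7 by rewrite cardsC1 card_ord.
  rewrite -cardsUI (disjoint_setI0 dij) cards0 addn0 -[leqRHS]c7.
  apply: subset_leq_card.
  apply/subsetP => j; rewrite !inE /= /m.
  by case: eqVneq => [->|//]; rewrite sedge_irr ?eqxx.
have [F [MF FK cF]] := set_between MK cM cEK.
exists (@del_edges K F).
  by exists F; split=> //; exists id => //; exists id.
apply: gminor_minor; apply: gminor_trans HG.
exists (fun i : K => [set g i]); split=> [u|u v uv|u v /andP[uv nF]].
- exact: conn1.
- by rewrite disjoints1 inE (inj_eq gI).
- exists (g u); first by rewrite inE.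
  apply/nbsP; exists (g v); first by rewrite inE.
  rewrite sedge_sym; apply: contraNT nF => nuv; apply: (subsetP MF).
  by apply/imsetP; exists (u, v); rewrite // inE /= /m [u != v]uv.
Qed.

(** * Contracting branch sets onto vertices *)

(* The branch set Z replaces the vertex a of W; contracting it onto a adds the
   edges from a to Q. *)
Definition rooted (G : sgraph) (W : {set G}) (a : G) (Z Q : {set G}) : Prop :=
  [/\ conn Z, Z :&: W = [set a], Q \subset W, a \notin Q
    & forall q, q \in Q -> ~~ (a -- q) /\ q \in nbs Z].

Lemma rooted0 (G : sgraph) (W : {set G}) a : a \in W -> rooted W a [set a] set0.
Proof.
move=> aW; split; rewrite ?sub0set ?inE //; first exact: conn1.
  by apply/setIidPl; rewrite sub1set.
by move=> q; rewrite inE.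
Qed.

(** The new graph lives on [W], with [Z] and [Z'] as the branch sets of [a] and [a'] and singletons
    elsewhere. The condition [a' \notin Q] prevents the pair of [a] and [a'] from being counted as a
    gain twice. *)
Lemma contract2 (G : sgraph) (W : {set G}) a Z Q a' Z' Q' :
  rooted W a Z Q -> rooted W a' Z' Q' -> [disjoint Z & Z'] -> a' \notin Q ->
  exists H : sgraph, [/\ #|H| = #|W|, gminor H G
    & dsum W + #|Q|.*2 + #|Q'|.*2 <= dsum [set: H]].
Proof.
move=> [cZ ZW QW aQ Qa] [cZ' ZW' QW' aQ' Qa'] dZ aQ2.
have /setIP[aZ aW] : a \in Z :&: W by rewrite ZW inE.
have /setIP[aZ' aW'] : a' \in Z' :&: W by rewrite ZW' inE.
have aa' : a != a' by apply: contraTneq aZ' => <-; rewrite (disjointFr dZ).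
pose p (x y : G) := (x == a) && (y \in Q) || (x == a') && (y \in Q').
pose q (x y : G) := [|| x -- y, p x y | p y x].
pose T := {x : G | x \in W}.
pose e : rel T := fun x y => q (val x) (val y).
have esym : symmetric e by move=> x y; rewrite /e /q sedge_sym [p _ _ || _]orbC.
have eirr : irreflexive e.
  move=> x; rewrite /e /q sedge_irr orbb /=; apply/negbTE; rewrite negb_or !negb_and.
  by apply/andP; split; case: eqP => // ->.
have valW : val @: [set: T] = W.
  apply/setP => x; apply/imsetP/idP => [[y _ ->]|xW]; first exact: valP.
  by exists (Sub x xW).
pose B (x : T) := if val x == a then Z else if val x == a' then Z' else [set val x].
have Broot (x : T) : val x \in B x.
  by rewrite /B; case: eqP => [->|_] //; case: eqP => [->|_] //; rewrite inE.
exists (SGraph esym eirr); split.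
- by rewrite /= card_sig; apply: eq_card => x; rewrite !inE.
- exists B; split=> [u|u v uv|u v uv].
  + by rewrite /B; case: eqP => // _; case: eqP => // _; apply: conn1.
  + have vuv : val u != val v by rewrite (inj_eq val_inj).
    have out x Y : Y :&: W = [set x] -> val v != x -> val v \notin Y.
      move=> YW; apply: contraNN => vY.
      by rewrite -in_set1 -YW inE vY (valP v).
    have out' x Y : Y :&: W = [set x] -> val u != x -> val u \notin Y.
      move=> YW; apply: contraNN => vY.
      by rewrite -in_set1 -YW inE vY (valP u).
    rewrite /B; case: (eqVneq (val u) a) => ua; case: (eqVneq (val v) a) => va.
    * by rewrite ua va eqxx in vuv.
    * by case: eqP => // _; rewrite disjoint_sym disjoints1 (out a).
    * by case: eqP => _; rewrite ?disjoints1 ?(out' a) // disjoint_sym.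
    case: (eqVneq (val u) a') => ua'; case: (eqVneq (val v) a') => va'.
    * by rewrite ua' va' eqxx in vuv.
    * by rewrite disjoint_sym disjoints1 (out a').
    * by rewrite disjoints1 (out' a').
    * by rewrite disjoints1 inE.
  + have Bp x y : p (val x) (val y) -> val y \in nbs (B x).
      move=> /orP[|] /andP[/eqP xa yQ]; rewrite /B xa eqxx; first by case: (Qa _ yQ).
      by rewrite eq_sym (negbTE aa'); case: (Qa' _ yQ).
    case/or3P: uv => [uv|/Bp|/Bp uv].
    * exists (val u) => //; apply/nbsP; exists (val v) => //.
      by rewrite sedge_sym.
    * by move=> /nbsP[x xu xv]; exists x => //; apply/nbsP; exists (val v); rewrite // sedge_sym.
    * by exists (val u).
rewrite /dsum.
have sT (F : G -> nat) : \sum_(x : T) F (val x) = \sum_(x in W) F x.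
  rewrite -[in RHS]valW big_imset /=; last by move=> x y _ _; apply: val_inj.
  by apply: eq_bigl => x; rewrite inE.
have -> : \sum_(x in [set: SGraph esym eirr]) #|nb x :&: [set: SGraph esym eirr]|
   = \sum_(x in W) \sum_(y in W) (q x y : nat).
  rewrite -sT; apply: eq_big => [x|x _]; first by rewrite inE.
  by rewrite card_nbI -sT; apply: eq_bigl => y; rewrite inE.
have cQ (R : {set G}) b : R \subset W -> b \in W ->
    #|R| = \sum_(x in W) \sum_(y in W) ((x == b) && (y \in R) : nat).
  move=> RW bW; rewrite (bigD1 b) //= [X in _ + X]big1 ?addn0 => [|x /andP[_ /negbTE xb]].
    by rewrite eqxx -card_setI_sum (setIidPl RW).
  by apply: big1 => y _; rewrite xb.
have sQ (R : {set G}) b : R \subset W -> b \in W -> #|R|.*2 =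
    \sum_(x in W) \sum_(y in W) (((x == b) && (y \in R) : nat) + ((y == b) && (x \in R) : nat)).
  move=> RW bW; rewrite -addnn [X in X + _](cQ R b) // [X in _ + X](cQ R b) //.
  rewrite [X in _ + X]exchange_big -big_split; apply: eq_bigr => x _.
  by rewrite -big_split.
rewrite (sQ Q a) // (sQ Q' a') // (eq_bigr _ (fun x _ => card_nbI x W)) -!big_split /=.
apply: leq_sum => x _; rewrite -!big_split; apply: leq_sum => y _ /=.
have nQ z : z \in Q -> (a -- z) = false by case/Qa => /negbTE.
have nQ' z : z \in Q' -> (a' -- z) = false by case/Qa' => /negbTE.
rewrite /q /p.
(* An ordered pair can be adjacent for five reasons: an old edge, or a new edge at [a] or at [a'] in
   either orientation. These exclude each other pairwise, so the five indicators sum to at most the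
   indicator of adjacency. *)
have h1 : ~~ ((x -- y) && ((x == a) && (y \in Q))).
  by apply/and3P => -[xy /eqP xa /nQ]; rewrite -xa xy.
have h2 : ~~ ((x -- y) && ((y == a) && (x \in Q))).
  by apply/and3P => -[xy /eqP xa /nQ]; rewrite -xa sedge_sym xy.
have h3 : ~~ ((x -- y) && ((x == a') && (y \in Q'))).
  by apply/and3P => -[xy /eqP xa /nQ']; rewrite -xa xy.
have h4 : ~~ ((x -- y) && ((y == a') && (x \in Q'))).
  by apply/and3P => -[xy /eqP xa /nQ']; rewrite -xa sedge_sym xy.
have h5 : ~~ (((x == a) && (y \in Q)) && ((y == a) && (x \in Q))).
  by apply/and3P => -[/andP[_ yQ] /eqP ya _]; rewrite -ya yQ in aQ.
have h6 : ~~ (((x == a') && (y \in Q')) && ((y == a') && (x \in Q'))).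
  by apply/and3P => -[/andP[_ yQ] /eqP ya _]; rewrite -ya yQ in aQ'.
have h7 : ~~ (((x == a) && (y \in Q)) && ((x == a') && (y \in Q'))).
  by apply/and3P => -[/andP[/eqP xa _] /eqP xa' _]; rewrite -xa -xa' eqxx in aa'.
have h8 : ~~ (((y == a) && (x \in Q)) && ((y == a') && (x \in Q'))).
  by apply/and3P => -[/andP[/eqP xa _] /eqP xa' _]; rewrite -xa -xa' eqxx in aa'.
have h9 : ~~ (((x == a) && (y \in Q)) && ((y == a') && (x \in Q'))).
  by apply/and3P => -[/andP[_ yQ] /eqP ya _]; rewrite -ya yQ in aQ2.
have h0 : ~~ (((y == a) && (x \in Q)) && ((x == a') && (y \in Q'))).
  by apply/and3P => -[/andP[_ yQ] /eqP ya _]; rewrite -ya yQ in aQ2.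
move: (x -- y) ((x == a) && (y \in Q)) ((y == a) && (x \in Q))
  ((x == a') && (y \in Q')) ((y == a') && (x \in Q')) h1 h2 h3 h4 h5 h6 h7 h8 h9 h0.
by do 5 case.
Qed.

(** * Density bounds for minors of a minimal counterexample *)

(** In degree sums, 4.5n - 12 edges become 9n - 24. The upper bound records that deleting one edge,
    a loss of 2, must break the lower bound. Order 8 is left out because there the lower bound is
    48, which is already dense. *)
Definition mincex (G : sgraph) : Prop :=
  [/\ 9 <= #|G|, 9 * #|G| <= dsum [set: G] + 24, dsum [set: G] + 23 <= 9 * #|G|
    & forall H : sgraph, gminor H G -> 8 <= #|H| -> #|H| < #|G| ->
      dsum [set: H] + 25 <= 9 * #|H|].

Lemma gminor_refl (G : sgraph) : gminor G G.
Proof.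
exists set1; split=> [u|u v uv|u v uv]; first exact: conn1.
  by rewrite disjoints1 inE.
exists u; first by rewrite inE.
by apply/nbsP; exists v; rewrite ?inE // sedge_sym.
Qed.

Lemma delete_edge (G : sgraph) : 0 < dsum [set: G] ->
  exists H : sgraph, [/\ #|H| = #|G|, gminor H G & dsum [set: H] + 2 = dsum [set: G]].
Proof.
move=> dG; have [x [y xy]] : exists x y : G, x -- y.
  have /existsP[x /existsP[y xy]] : [exists x : G, [exists y, x -- y]]; last by exists x, y.
  apply: contraLR dG => /existsPn n; rewrite -leqNgt leqn0; apply/eqP.
  apply: big1 => x _; apply: eq_card0 => y; rewrite !inE andbT.
  by have /existsPn/(_ y)/negbTE := n x.
pose r : rel G := fun u v => (u -- v) && ([set u; v] != [set x; y]).
have rsym : symmetric r by move=> u v; rewrite /r sedge_sym setUC.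
have rirr : irreflexive r by move=> u; rewrite /r sedge_irr.
have xNy : x != y by apply: contraTneq xy => ->; rewrite sedge_irr.
exists (SGraph rsym rirr); split=> //.
  exists set1; split=> [u|u v uv|u v /andP[uv _]]; first exact: conn1.
    by rewrite disjoints1 inE.
  exists u; first by rewrite inE.
  by apply/nbsP; exists v; rewrite ?inE // sedge_sym.
rewrite !dsum_setT (bigD1 x) //= (bigD1 y) //= 1?eq_sym // [RHS](bigD1 x) //=.
rewrite [X in _ = _ + X](bigD1 y) //= 1?eq_sym //.
have card1 a b : a -- b -> [set x; y] = [set a; b] ->
    #|nb a| = #|nb (a : SGraph rsym rirr)| + 1.
  move=> ab abE; rewrite (cardsD1 b) inE ab addnC; congr (_ + _); apply: eq_card => z.
  rewrite !inE /= /r [RHS]andbC abE; case: (boolP (a -- z)) => az; rewrite ?andbF // !andbT.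
  congr (~~ _); apply/eqP/eqP => [->//|/setP/(_ z)].
  rewrite !inE eqxx orbT => /esym/orP[]/eqP // za.
  by rewrite za sedge_irr in az.
have nx := card1 _ _ xy erefl.
have ny : #|nb y| = #|nb (y : SGraph rsym rirr)| + 1.
  by apply: (card1 _ x); rewrite 1?sedge_sym // setUC.
rewrite nx ny.
rewrite (eq_bigr (fun u : G => #|nb u|)); 
  have aux a b c : a + (b + c) + 2 = a + 1 + (b + 1 + c) by nlia.
  exact: aux.
move=> u /andP[ux uy]; apply: eq_card => z; rewrite !inE /= /r.
case: (u -- z) => //=; apply/negP => /eqP/setP/(_ u).
by rewrite !inE eqxx (negbTE ux) (negbTE uy).
Qed.

(** Induction on the order, then on the degree sum. From 9n - 22 upwards, deleting an edge keeps the
    bound; below that, either some smaller minor satisfies the bound and induction applies, or the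
    graph is a minimal counterexample. *)
Lemma mincex_dense8 : (forall G, ~ mincex G) ->
  forall G : sgraph, 8 <= #|G| -> 9 * #|G| <= dsum [set: G] + 24 -> dense8_minor G.
Proof.
move=> nmc G; have [n] := ubnP #|G|; elim: n G => // n IHn G.
have [m] := ubnP (dsum [set: G]); elim: m G => // m IHm G ltGm ltGn n8 dG.
case: (leqP #|G| 8) => [le8|n9].
  have e8 : #|G| = 8 by apply/eqP; rewrite eqn_leq le8.
  exists G; split=> //; last exact: gminor_refl.
  by rewrite e8 in dG; move: dG; clear; nlia.
case: (leqP (dsum [set: G] + 23) (9 * #|G|)) => [le23|gt23].
  apply: NNPP => nW; apply: (nmc G); split=> // H HG h8 hG.
  rewrite leqNgt; apply/negP => dH; apply: nW; apply: (dense8_minor_trans HG).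
  apply: IHn => //; nlia.
have [|H [cH HG dH]] := @delete_edge G; first by nlia.
apply: (dense8_minor_trans HG); apply: IHm; rewrite ?cH //; nlia.
Qed.

Lemma mc_contract2 (G : sgraph) (W : {set G}) a Z Q a' Z' Q' :
  mincex G -> rooted W a Z Q -> rooted W a' Z' Q' -> [disjoint Z & Z'] -> a' \notin Q ->
  8 <= #|W| -> #|W| < #|G| ->
  dsum W + #|Q|.*2 + #|Q'|.*2 + 25 <= 9 * #|W|.
Proof.
move=> [_ _ _ mc] ra ra' dZ aQ w8 wG.
have [H [cH HG dH]] := contract2 ra ra' dZ aQ.
have := mc H HG; rewrite cH => /(_ w8 wG); nlia.
Qed.

Lemma contract1 (G : sgraph) (W : {set G}) a Z Q :
  rooted W a Z Q -> 2 <= #|W| ->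
  exists H : sgraph, [/\ #|H| = #|W|, gminor H G
    & dsum W + #|Q|.*2 <= dsum [set: H]].
Proof.
move=> ra w2; have [cZ ZW QW aQ Qa] := ra.
have [b] : exists b, b \in W :\ a.
  apply/set0Pn; rewrite -card_gt0; have := cardsD1 a W.
  have -> : a \in W by have : a \in Z :&: W; [rewrite ZW inE | case/setIP].
  by nlia.
rewrite !inE => /andP[ba bW].
have dbZ : [disjoint [set b] & Z].
  rewrite disjoints1; apply: contra ba => bZ.
  by rewrite -in_set1 -ZW inE bZ.
have [|H [cH HG]] := contract2 (rooted0 bW) ra dbZ; first by rewrite inE.
by rewrite cards0 addn0 => dH; exists H.
Qed.

Lemma contract1_le (G : sgraph) (W : {set G}) a Z Q :
  rooted W a Z Q -> 2 <= #|W| -> dsum W + #|Q|.*2 <= #|W| * #|W|.-1.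
Proof.
move=> ra w2; have [H [cH _ dH]] := contract1 ra w2.
by apply: leq_trans dH _; rewrite -cH -cardsT; apply: dsum_le.
Qed.

Lemma mc_contract1 (G : sgraph) (W : {set G}) a Z Q :
  mincex G -> rooted W a Z Q -> 8 <= #|W| -> #|W| < #|G| ->
  dsum W + #|Q|.*2 + 25 <= 9 * #|W|.
Proof.
move=> [_ _ _ mc] ra w8 wG.
have [|H [cH HG dH]] := contract1 ra; first by nlia.
have := mc H HG; rewrite cH => /(_ w8 wG); nlia.
Qed.

Lemma mc_sub (G : sgraph) (W : {set G}) :
  mincex G -> 8 <= #|W| -> #|W| < #|G| -> dsum W + 25 <= 9 * #|W|.
Proof.
move=> mc w8 wG; have /card_gt0P[a aW] : 0 < #|W| by nlia.
have := mc_contract1 mc (rooted0 aW) w8 wG; rewrite cards0; nlia.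
Qed.

Lemma dsumU1 (G : sgraph) (W : {set G}) v : v \notin W ->
  dsum (v |: W) = dsum W + (#|nb v :&: W|).*2.
Proof.
move=> vW; rewrite (@dsumD1 _ _ v) ?setU11 // setU1K //; congr (_ + _.*2).
apply: eq_card => y; rewrite !inE; case: eqP => // ->.
by rewrite sedge_irr.
Qed.

Lemma rooted_attach (G : sgraph) (W V D : {set G}) x :
  conn D -> W \subset V -> x \in D -> x \in V -> [disjoint D & V :\ x] ->
  rooted V x D ((nbs D :&: W) :\: nb x :\ x).
Proof.
move=> cD WV xD xV dDV; split=> //.
- apply/setP => z; rewrite !inE; case: eqVneq => [->|zx]; first by rewrite xD xV.
  by apply/negP => /andP[zD zV]; move: (disjointFr dDV zD); rewrite !inE zx zV.
- by apply/subsetP => z; rewrite !in_setD in_setI => /and4P[_ _ _ /(subsetP WV)].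
- by rewrite !inE eqxx.
- by move=> q; rewrite !in_setD in_setI => /and4P[_ xq ->] _; rewrite inE in xq.
Qed.

Lemma card_attach (G : sgraph) (W D : {set G}) x : x \in D -> x \notin W ->
  #|nb x :&: W| + #|(nbs D :&: W) :\: nb x :\ x| = #|nbs D :&: W|.
Proof.
move=> xD xW; rewrite -[RHS](cardsID (nb x)); congr (_ + _); apply: eq_card => z.
  rewrite !in_setI; case: (boolP (z \in nb x)) => xz; rewrite ?andbF ?andbT //=.
  have -> // : z \in nbs D.
  by apply/nbsP; exists x => //; rewrite inE in xz.
by rewrite in_setD1 in_setD in_setI; case: eqVneq => // ->; rewrite (negbTE xW) !andbF.
Qed.

(** Contracting [D] onto one of its vertices adds to [W] a vertex of degree [#|nbs D :&: W|]: by
    [card_attach], its old edges to [W] and the gained ones add up to this number. *)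
Lemma mc_attach (G : sgraph) (W D : {set G}) : mincex G ->
  conn D -> [disjoint D & W] -> 7 <= #|W| -> #|W|.+1 < #|G| ->
  dsum W + #|nbs D :&: W|.*2 + 25 <= 9 * #|W|.+1.
Proof.
move=> mc cD dDW w7 wG; have [/set0Pn[x xD] _] := cD.
have xW : x \notin W by rewrite (disjointFr dDW).
have := mc_contract1 mc (@rooted_attach _ W (x |: W) D x cD _ xD _ _).
rewrite subsetUr setU11 setU1K // dDW cardsU1 xW add1n dsumU1 //.
have := card_attach xD xW; move=> <- /(_ isT isT isT) h; have := h w7 wG; nlia.
Qed.

Lemma disjointsU1 (T : finType) (D W : {set T}) x :
  [disjoint D & x |: W] = (x \notin D) && [disjoint D & W].
Proof.
by rewrite -!setI_eq0 setIUr setU_eq0 !setI_eq0 disjoint_sym disjoints1.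
Qed.

(** Two contracted sets extend [W] by two vertices, and an edge between the chosen roots [x] and
    [x'] counts in addition. *)
Lemma mc_attach2 (G : sgraph) (W D D' : {set G}) x x' : mincex G ->
  conn D -> conn D' -> [disjoint D & W] -> [disjoint D' & W] -> [disjoint D & D'] ->
  x \in D -> x' \in D' -> 6 <= #|W| -> #|W|.+2 < #|G| ->
  dsum W + #|nbs D :&: W|.*2 + #|nbs D' :&: W|.*2 + (x -- x').*2 + 25 <= 9 * #|W|.+2.
Proof.
move=> mc cD cD' dDW dDW' dDD xD xD' w6 wG.
have xW : x \notin W by rewrite (disjointFr dDW).
have xW' : x' \notin W by rewrite (disjointFr dDW').
have xx' : x != x' by apply: contraTneq xD' => <-; rewrite (disjointFr dDD).
have xxW : x \notin x' |: W by rewrite !inE negb_or xx'.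
have WV : W \subset x |: (x' |: W) by rewrite setUCA subsetU // subsetUr orbT.
have r1 : rooted (x |: (x' |: W)) x D ((nbs D :&: W) :\: nb x :\ x).
  apply: rooted_attach => //; rewrite ?setU11 // setU1K // disjointsU1.
  by rewrite (disjointFl dDD).
have r2 : rooted (x |: (x' |: W)) x' D' ((nbs D' :&: W) :\: nb x' :\ x').
  apply: rooted_attach => //; rewrite ?inE ?eqxx ?orbT // setUCA setU1K.
    by rewrite disjointsU1 (disjointFr dDD).
  by rewrite !inE negb_or eq_sym xx'.
have := mc_contract2 mc r1 r2 dDD.
rewrite !cardsU1 xxW xW' !add1n !dsumU1 // => /(_ _ w6 wG).
have <- := card_attach xD xW; have <- := card_attach xD' xW'.
have -> : #|nb x :&: (x' |: W)| = (x -- x') + #|nb x :&: W|.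
  rewrite card_setIU_disj ?disjoints1 //; congr (_ + _).
  by rewrite card_setI_sum big_set1 inE.
move=> h; have := h _; rewrite !inE (negbTE xW') !andbF => /(_ isT) {h}.
by move: (nat_of_bool _) => b; clear; nlia.
Qed.

(** * Minimal counterexamples *)

(** Contracting [x -- y] inside [W] loses one vertex, the edge itself and one edge per common
    neighbour. The constant is 32 = 25 - 2 + 9. *)
Lemma mc_common_in (G : sgraph) (W : {set G}) x y : mincex G ->
  x \in W -> y \in W -> x -- y -> 9 <= #|W| ->
  dsum W + 32 <= 9 * #|W| + (#|nb x :&: nb y :&: W|).*2.
Proof.
move=> mc xW yW xy w9; have xNy : x != y by apply: contraTneq xy => ->; rewrite sedge_irr.
have cWy := cardsD1 y W; rewrite yW in cWy.
have wG : #|W| <= #|G| by apply: max_card.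
have cZ : conn [set x; y].
  by apply: (@connU _ _ _ x y); rewrite ?inE ?eqxx ?xy ?orbT //; apply: conn1.
have r : rooted (W :\ y) x [set x; y] ((nb y :&: W) :\: nb x :\ x).
  split=> //.
  - apply/setP => z; rewrite !inE; case: eqVneq => [->|zx]; first by rewrite xNy xW.
    by case: eqVneq.
  - apply/subsetP => z; rewrite !inE => /and4P[_ _ yz ->]; rewrite andbT.
    by apply: contraTneq yz => ->; rewrite sedge_irr.
  - by rewrite !inE eqxx.
  move=> q; rewrite in_setD1 in_setD in_setI => /and4P[_ xq yq _].
  split; first by rewrite inE in xq.
  by apply/nbsP; exists y; [rewrite !inE eqxx orbT | rewrite inE in yq].
have := mc_contract1 mc r; have := dsumD1 yW.
have : #|nb y :&: W| = #|(nb y :&: W) :\: nb x :\ x| + #|nb x :&: nb y :&: W| + 1.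
  rewrite -(cardsID (nb x)) (cardsD1 x ((nb y :&: W) :\: nb x)).
  rewrite !inE sedge_irr xW sedge_sym xy /=.
  have -> : nb y :&: W :&: nb x = nb x :&: nb y :&: W by rewrite setIC setIA.
  by nlia.
nlia.
Qed.

Lemma mc_common (G : sgraph) (x y : G) : mincex G -> x -- y -> 4 <= #|nb x :&: nb y|.
Proof.
move=> mc xy; have [n9 lo _ _] := mc.
have := @mc_common_in _ [set: G] x y mc; rewrite !inE cardsT setIT => h.
have := h isT isT xy n9; nlia.
Qed.

(** Deleting a vertex of degree d lowers the degree sum by 2d and the threshold by 9, and the bound
    for smaller minors is stricter by one; hence 2d is at least 10. *)
Lemma mc_deg5 (G : sgraph) (x : G) : mincex G -> 5 <= #|nb x|.
Proof.
move=> mc; have [n9 lo _ _] := mc.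
have := dsumD1 (in_setT x); rewrite setIT.
have := @mc_sub _ ([set: G] :\ x) mc; have := cardsD1 x [set: G].
rewrite inE cardsT; nlia.
Qed.

Lemma closed_nb_clique (G : sgraph) (x : G) :
  (forall a, x -- a -> #|nb x|.-1 <= #|nb x :&: nb a|) ->
  forall a b, a \in x |: nb x -> b \in x |: nb x -> a != b -> a -- b.
Proof.
move=> h a b; rewrite !inE => /orP[/eqP->|xa] /orP[/eqP->|xb] //.
- by rewrite eqxx.
- by rewrite sedge_sym.
move=> ab.
have sub : nb x :&: nb a \subset nb x :\ a.
  apply/subsetP => z; rewrite !inE => /andP[-> az]; rewrite andbT.
  by apply: contraTneq az => ->; rewrite sedge_irr.
have /eqP E : nb x :&: nb a == nb x :\ a.
  rewrite eqEcard sub; have := h _ xa; have := cardsD1 a (nb x).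
  rewrite inE xa; nlia.
have : b \in nb x :\ a by rewrite !inE xb eq_sym ab.
by rewrite -E !inE => /andP[].
Qed.

Lemma card_nbU1 (G : sgraph) (x : G) : #|x |: nb x| = #|nb x|.+1.
Proof. by rewrite cardsU1 inE sedge_irr. Qed.

Lemma exists_le_mean (T : finType) (F : T -> nat) (W : {set T}) k :
  \sum_(x in W) F x < k.+1 * #|W| -> exists2 x, x \in W & F x <= k.
Proof.
move=> h; have /existsP[x /andP[xW Fx]] : [exists x in W, F x <= k]; last by exists x.
apply: contraLR h => /existsPn n; rewrite -leqNgt mulnC -sum_nat_const.
by apply: leq_sum => x xW; have := n x; rewrite xW /= ltnNge.
Qed.

(** On nine vertices parity forces degree sum 58, which gives minimum degree 6 and five common
    neighbours for every edge. A vertex of degree 6 exists and its closed neighbourhood is a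
    complete graph on seven vertices; a vertex outside has at least five neighbours in it, which
    gives too many edges on eight vertices. *)
Lemma mc_n10 (G : sgraph) : mincex G -> 10 <= #|G|.
Proof.
move=> mc; have [n9 lo hi _] := mc; case: (ltnP 9 #|G|) => // n9'.
have n : #|G| = 9 by nlia.
have deg6 (x : G) : 6 <= #|nb x|.
  have := dsumD1 (in_setT x); rewrite setIT.
  have := @mc_sub _ ([set: G] :\ x) mc; have := cardsD1 x [set: G].
  have := dsum_even [set: G]; rewrite inE cardsT; nlia.
have com (x y : G) : x -- y -> 5 <= #|nb x :&: nb y|.
  move=> xy; have := @mc_common_in _ [set: G] x y mc; rewrite !inE cardsT setIT => h.
  have := h isT isT xy n9; have := dsum_even [set: G]; nlia.
have [|x _ dx] := @exists_le_mean G (fun x => #|nb x :&: [set: G]|) [set: G] 6.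
  by rewrite cardsT -/(dsum [set: G]) n; nlia.
rewrite setIT in dx; have {}dx : #|nb x| = 6 by have := deg6 x; nlia.
have clq : dsum (x |: nb x) = 42.
  rewrite dsum_clique ?card_nbU1 ?dx //; apply: closed_nb_clique => a xa.
  by rewrite dx; apply: com.
have [y yx] : exists y, y \in ~: (x |: nb x).
  by apply/set0Pn; rewrite -card_gt0 cardsCs setCK card_nbU1 dx n.
rewrite inE in yx.
have := @mc_sub _ (y |: (x |: nb x)) mc; rewrite cardsU1 yx card_nbU1 dx dsumU1 // clq n.
have : 5 <= #|nb y :&: (x |: nb x)|; last by nlia.
have := deg6 y; rewrite -(cardsID (x |: nb x)).
have : #|nb y :\: (x |: nb x)| <= #|~: (y |: (x |: nb x))|.
  apply: subset_leq_card; apply/subsetP => z; rewrite !inE => /andP[zx yz].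
  by rewrite (negbTE zx) orbF; apply: contraTneq yz => ->; rewrite sedge_irr.
by have := cardsC (y |: (x |: nb x)); rewrite cardsU1 yx card_nbU1 dx n; nlia.
Qed.

(** * Counting over small separations *)

(* The two sides of a separation with n vertices over a clique of size k have
   n1 and n2 vertices, and s1 and s2 are twice their numbers of edges. *)
Lemma cut_arith n n1 n2 k s s1 s2 :
  k <= 4 -> 10 <= n -> odd n = false -> n1 + n2 = n + k -> s + 24 = 9 * n ->
  s + k * k.-1 <= s1 + s2 -> 6 <= n1 -> 7 <= n2 ->
  (8 <= n1 -> s1 + 25 <= 9 * n1) -> (8 <= n2 -> s2 + 25 <= 9 * n2) ->
  s1 <= n1 * n1.-1 -> s2 <= n2 * n2.-1 ->
  (n1 = 7 -> k = 4 -> s1 + 8 <= 47) -> (n2 = 7 -> s2 + k.*2 <= 47) ->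
  odd s1 = false -> odd s2 = false -> False.
Proof.
move=> k4 n10 no nE sE cut n16 n27 h1 h2 b1 b2 a1 a2 o1 o2.
(* If both sides have at least 8 vertices, adding their bounds gives k^2 - 10k + 26 <= 0, which is
   impossible. Smaller sides are bounded by complete graphs, and a side of order 7 also by 47 = 9 *
   8 - 25 once an eighth vertex is attached. *)
have [n1E|[n1E|n18]] : n1 = 6 \/ n1 = 7 \/ 8 <= n1 by nlia.
- subst n1; have [n2E|n28] : n2 = 7 \/ 8 <= n2 by nlia.
    by subst n2; have := a2 erefl; case: k k4 nE cut {a1 a2} => [|[|[|[|[|]]]]] //=; nlia.
  by have := h2 n28; case: k k4 nE cut {a1 a2} => [|[|[|[|[|]]]]] //=; nlia.
- subst n1; have := a1 erefl; have [n2E|n28] : n2 = 7 \/ 8 <= n2 by nlia.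
    by subst n2; have := a2 erefl; case: k k4 nE cut {a1 a2} => [|[|[|[|[|]]]]] //=; nlia.
  by have := h2 n28; case: k k4 nE cut {a1 a2} => [|[|[|[|[|]]]]] //=; nlia.
have := h1 n18; have [n2E|n28] : n2 = 7 \/ 8 <= n2 by nlia.
  by subst n2; have := a2 erefl; case: k k4 nE cut {a1 a2} => [|[|[|[|[|]]]]] //=; nlia.
by have := h2 n28; case: k k4 nE cut {a1 a2} => [|[|[|[|[|]]]]] //=; nlia.
Qed.

(** No edge leaves [D] except to [L], so the two sides cover all edges, and those inside [L] are
    counted twice. *)
Lemma dsum_cut (G : sgraph) (D L : {set G}) : [disjoint D & L] ->
  (forall x, x \in D -> nb x \subset D :|: L) ->
  dsum [set: G] + dsum L = dsum (D :|: L) + dsum (~: D).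
Proof.
move=> dDL DL; rewrite -(setUCr D) dsumU ?dsumU //; last by rewrite -setI_eq0 setICr.
have -> : cross D (~: D) = cross D L; last by nlia.
apply: eq_bigr => x xD; apply: eq_card => z; rewrite !inE.
case: (boolP (x -- z)) => //= xz; have := subsetP (DL _ xD) z.
rewrite !inE => /(_ xz); case: (boolP (z \in D)) => //= zD.
by rewrite (disjointFr dDL zD).
Qed.

Lemma mul_pred_double l : l * l.-1 + l.*2 = l.+1 * l.
Proof. by case: l => // l; rewrite /= -muln2 -mulnDr addn2 mulnC. Qed.

(** * Vertices of degree five *)

(** Deleting [y] loses only 10, so the degree sum of [G] is at most 9n - 24 and equality holds;
    parity then makes n even. *)
Lemma deg5_dsum_eq (G : sgraph) (y : G) : mincex G -> #|nb y| = 5 ->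
  dsum [set: G] + 24 = 9 * #|G| /\ odd #|G| = false.
Proof.
move=> mc y5; have n10 := mc_n10 mc; have [_ lo hi _] := mc.
have := dsumD1 (in_setT y); rewrite setIT y5.
have := @mc_sub _ ([set: G] :\ y) mc; have := cardsD1 y [set: G].
have := dsum_even [set: G]; rewrite inE cardsT; nlia.
Qed.

Lemma deg5_clique (G : sgraph) (y a b : G) : mincex G -> #|nb y| = 5 ->
  a \in y |: nb y -> b \in y |: nb y -> a != b -> a -- b.
Proof.
by move=> mc y5; apply: closed_nb_clique => c yc; rewrite y5; apply: mc_common.
Qed.

(** Without [y] the degree sum is 9m - 25 on m = n - 1 vertices, and [mc_common_in] still yields
    four common neighbours of [a] and [b]. Only three of them can lie in [nb y]. *)
Lemma deg5_pair (G : sgraph) (y a b : G) : mincex G -> #|nb y| = 5 ->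
  a \in nb y -> b \in nb y -> a != b ->
  exists v, [/\ v \in ~: (y |: nb y), a -- v & b -- v].
Proof.
move=> mc y5 ya yb ab; have n10 := mc_n10 mc; have [_ lo hi _] := mc.
have cTy := cardsD1 y [set: G]; rewrite inE cardsT in cTy.
have Wm z : z \in nb y -> z \in [set: G] :\ y.
  by rewrite !inE andbT => yz; apply: contraTneq yz => ->; rewrite sedge_irr.
have sub : (nb y :\ a) :\ b \subset nb a :&: nb b :&: ([set: G] :\ y).
  apply/subsetP => z /setD1P[zb /setD1P[za yz]].
  rewrite inE Wm // andbT !inE.
  by rewrite !(deg5_clique mc y5) ?setU1r // eq_sym.
have c4 : 4 <= #|nb a :&: nb b :&: ([set: G] :\ y)|.
  have ab' : a -- b by rewrite (deg5_clique mc y5) ?setU1r.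
  have := mc_common_in mc (Wm _ ya) (Wm _ yb) ab'.
  have := dsumD1 (in_setT y); rewrite setIT y5; nlia.
have /set0Pn[v] : (nb a :&: nb b :&: ([set: G] :\ y)) :\: (nb y :\ a :\ b) != set0.
  rewrite -card_gt0 cardsD (setIidPr sub).
  have := cardsD1 a (nb y); have := cardsD1 b (nb y :\ a).
  by rewrite ya in_setD1 yb eq_sym ab; nlia.
move=> /setDP[/setIP[/setIP[av bv]]]; rewrite in_setD1 => /andP[vy _] nv.
rewrite inE in av; rewrite inE in bv.
exists v; split=> //; rewrite in_setC in_setU1 negb_or vy /=.
apply: contra nv => yv; rewrite !in_setD1 yv andbT.
by apply/andP; split; [apply: contraTneq bv|apply: contraTneq av] => ->; rewrite sedge_irr.
Qed.

Lemma deg5_dsum_closed_nb (G : sgraph) (y : G) : mincex G -> #|nb y| = 5 -> dsum (y |: nb y) = 30.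
Proof.
move=> mc y5; rewrite dsum_clique ?card_nbU1 ?y5 // => a b.
exact: deg5_clique.
Qed.

(** If [D] missed [a], its neighbours [L] in the clique [nb y] would form a clique of at most four
    vertices separating [D] from the rest, against [cut_arith]. *)
Lemma deg5_component (G : sgraph) (y d : G) : mincex G -> #|nb y| = 5 ->
  d \in ~: (y |: nb y) -> nb y \subset nbs (component (~: (y |: nb y)) d).
Proof.
move=> mc y5; set R := ~: (y |: nb y); set D := component R d => dR.
have n10 := mc_n10 mc; have [_ lo hi _] := mc.
have [sE n_even] := deg5_dsum_eq mc y5.
have cD : conn D by apply: component_conn.
have DR : D \subset R by apply: component_sub.
apply/subsetP => a ya; apply: contraT => aD.
pose L := nb y :&: nbs D.
have dDA : [disjoint D & y |: nb y].
  by rewrite disjoints_subset.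
have dDL : [disjoint D & L].
  by apply: disjointWr dDA; rewrite subsetU // subsetIl orbT.
have DL x : x \in D -> nb x \subset D :|: L.
  move=> xD; apply/subsetP => z xz; have zn : z \in nbs D.
    by apply/nbsP; exists x => //; rewrite inE in xz.
  case: (component_nbs dR zn) => [zD|]; first by rewrite inE zD.
  rewrite inE negbK => /setU1P[zy|yz]; last by rewrite !in_setU !in_setI yz zn orbT.
  by move: (disjointFr dDA xD); rewrite !inE -zy sedge_sym; rewrite inE in xz; rewrite xz orbT.
have cutE := dsum_cut dDL DL.
have Lcl : dsum L = #|L| * #|L|.-1.
  apply: dsum_clique => u v /setIP[yu _] /setIP[yv _].
  by apply: (deg5_clique mc y5); rewrite setU1r.
have k4 : #|L| <= 4.
  have : L \subset nb y :\ a.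
    apply/subsetP => z /setIP[yz zD]; rewrite in_setD1 yz andbT.
    by apply: contraNneq aD => <-.
  by move/subset_leq_card; have := cardsD1 a (nb y); rewrite ya; nlia.
have n1E : #|D :|: L| = #|D| + #|L| by rewrite -cardsUI (disjoint_setI0 dDL) cards0 addn0.
have n2E : #|D| + #|~: D| = #|G| by rewrite cardsC.
have n16 : 6 <= #|D :|: L|.
  have dD : d \in D by apply: component_self.
  apply: leq_trans (_ : #|d |: nb d| <= _).
    by rewrite card_nbU1 ltnS mc_deg5.
  by apply: subset_leq_card; rewrite subUset sub1set inE dD DL.
(* A common neighbour of [a] and another vertex of [nb y] avoids [D], since [D] misses [a]. Together
   with the closed neighbourhood of [y] it gives the other side seven vertices. *)
have [v [vR vD]] : exists v, v \in R /\ v \notin D.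
  have /set0Pn[b] : nb y :\ a != set0.
    by rewrite -card_gt0; have := cardsD1 a (nb y); rewrite ya; nlia.
  move=> /setD1P[ba yb]; rewrite eq_sym in ba.
  have [v [vR av bv]] := deg5_pair mc y5 ya yb ba; exists v; split=> //.
  apply: contra aD => vD; apply/nbsP; exists v => //; by rewrite sedge_sym.
have n27 : 7 <= #|~: D|.
  apply: leq_trans (_ : #|v |: (y |: nb y)| <= _).
    by rewrite cardsU1 card_nbU1 y5; rewrite inE in vR; rewrite vR.
  apply: subset_leq_card; rewrite subUset sub1set inE vD /=.
  by rewrite -disjoints_subset disjoint_sym.
have yDL : y \notin D :|: L.
  rewrite inE negb_or (disjointFl dDA) ?setU11 //=.
  by rewrite !inE sedge_irr.
have nG : #|D :|: L| < #|G| by have := max_card (mem (D :|: L)); nlia.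
have Ls : nbs D :&: ~: D = L.
  apply/setP => z; rewrite in_setI in_setI [in RHS]andbC.
  case: (boolP (z \in nbs D)) => //= /nbsP[x xD xz].
  have := subsetP (DL _ xD) z; rewrite inE => /(_ xz).
  rewrite inE in_setI => /orP[zD|/andP[yz zn]].
    rewrite inE zD; have := disjointFr dDA zD; by rewrite in_setU1 => /norP[_ /negbTE].
  rewrite yz inE; have : z \in L by rewrite in_setI yz.
  by move/(disjointFl dDL) => ->.
exfalso; apply: (@cut_arith #|G| #|D :|: L| #|~: D| #|L| (dsum [set: G]) (dsum (D :|: L)) (dsum (~: D))) => //.
- nlia.
- nlia.
- by move=> n8; apply: mc_sub.
- move=> n8; apply: mc_sub => //; nlia.
- exact: dsum_le.
- exact: dsum_le.
(* Here [y], adjacent to all four vertices of [L], is the eighth vertex. *)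
- move=> n17 k4'.
  have := @mc_sub _ (y |: (D :|: L)) mc; rewrite cardsU1 yDL n17 dsumU1 //.
  have : #|L| <= #|nb y :&: (D :|: L)|.
    apply: subset_leq_card; apply/subsetP => z zL; rewrite in_setI in_setU zL orbT andbT.
    by case/setIP: zL.
  rewrite k4'; move=> ? h; have := h isT; rewrite add1n; nlia.
(* Here [D], contracted to a vertex adjacent to all of [L], is the eighth vertex. *)
- move=> n27'.
  have := mc_attach mc cD (_ : [disjoint D & ~: D]).
  rewrite Ls n27' -setI_eq0 setICr => /(_ (eqxx _) isT); nlia.
- exact: dsum_even.
- exact: dsum_even.
Qed.

(** Two components, each seeing all of [nb y], contract to two vertices next to the complete graph
    on [y |: nb y]: 15 + 5 + 5 = 25 edges on eight vertices. *)
Lemma deg5_conn (G : sgraph) (y : G) : mincex G -> #|nb y| = 5 ->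
  conn (~: (y |: nb y)).
Proof.
move=> mc y5; set R := ~: (y |: nb y).
have n10 := mc_n10 mc; have [_ lo hi _] := mc.
have [d dR] : exists d, d \in R.
  apply/set0Pn; rewrite -card_gt0; have := cardsC (y |: nb y).
  rewrite card_nbU1 y5 -/R; nlia.
have DR := component_sub dR; case: (eqVneq (component R d) R) => [<-|nDR]; first exact: component_conn.
have /set0Pn[e /setDP[eR eD]] : R :\: component R d != set0.
  by apply: contra nDR; rewrite setD_eq0 eqEsubset DR => ->.
have ER := component_sub eR.
have dDE : [disjoint component R d & component R e].
  rewrite -setI_eq0; apply/eqP/setP => z; rewrite in_setI in_set0; apply/negP.
  move=> /andP[zd ze]; case/negP: eD.
  apply: (subsetP (conn_sub (component_conn R e) _ ze zd)) (component_self _ _).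
  move=> u v ud _ vE; apply: component_closed => //.
    exact: (subsetP DR).
  exact: (subsetP ER).
have dA (X : {set G}) : X \subset R -> [disjoint X & y |: nb y] by rewrite disjoints_subset.
have := mc_attach2 mc (component_conn R d) (component_conn R e) (dA _ DR) (dA _ ER) dDE
  (component_self R d) (component_self R e).
rewrite card_nbU1 y5 deg5_dsum_closed_nb // => /(_ isT).
have l5 x : x \in R -> 5 <= #|nbs (component R x) :&: (y |: nb y)|.
  move=> xR; rewrite -y5; apply: subset_leq_card; rewrite subsetI deg5_component //.
  exact: subsetUr.
have := l5 _ dR; have := l5 _ eR; move: (nat_of_bool _) => c; nlia.
Qed.

(** Some edge joins [X] and [Y], so contracting both next to the complete graph on [y |: nb y]
    allows at most seven attachments in total. If one part misses [i], then by [deg5_pair] every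
    pair through [i] has a common neighbour in the other part, which therefore sees all of
    [nb y]. *)
Lemma deg5_split (G : sgraph) (y : G) (X Y : {set G}) : mincex G -> #|nb y| = 5 ->
  conn X -> conn Y -> [disjoint X & Y] -> X :|: Y = ~: (y |: nb y) ->
  (nb y \subset nbs X /\ #|nb y :&: nbs Y| <= 2) \/
  (nb y \subset nbs Y /\ #|nb y :&: nbs X| <= 2).
Proof.
move=> mc y5 cX cY dXY XY.
have n10 := mc_n10 mc; have [_ lo hi _] := mc.
have cR := deg5_conn mc y5; rewrite -XY in cR.
have [/set0Pn[x0 x0X] _] := cX; have [/set0Pn[y0 y0Y] _] := cY.
have [x [z [xX zY xz]]] : exists x z, [/\ x \in X, z \in Y & x -- z].
  case: (boolP [exists x in X, [exists z in Y, x -- z]]).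
    by move=> /exists_inP[x xX /exists_inP[z zY xz]]; exists x, z.
  move=> /exists_inPn n; have /subsetP/(_ y0) : X :|: Y \subset X.
    apply: (conn_sub cR _ (x0 := x0)) => //; last by rewrite inE x0X.
    move=> u v uX _ /setUP[] // vY uv; have := n u uX.
    by case/exists_inP; exists v.
  rewrite inE y0Y orbT => /(_ isT); by rewrite (disjointFl dXY).
have dA (Z : {set G}) : Z \subset X :|: Y -> [disjoint Z & y |: nb y] by rewrite XY disjoints_subset.
have := mc_attach2 mc cX cY (dA _ (subsetUl _ _)) (dA _ (subsetUr _ _)) dXY xX zY.
rewrite card_nbU1 y5 deg5_dsum_closed_nb // xz => /(_ isT) h.
have lL (Z : {set G}) : #|nb y :&: nbs Z| <= #|nbs Z :&: (y |: nb y)|.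
  apply: subset_leq_card; rewrite setIC; exact/setIS/subsetUr.
have := lL X; have := lL Y => lY lX.
have l7 : #|nb y :&: nbs X| + #|nb y :&: nbs Y| <= 7 by move: (h (ltnW n10)) lX lY; clear; lia.
have full (Z Z' : {set G}) : (forall v, v \in X :|: Y -> v \in Z \/ v \in Z') ->
    ~~ (nb y \subset nbs Z') -> nb y \subset nbs Z.
  move=> cov /subsetPn[i yi iZ']; have onZ j : j \in nb y -> i != j -> (i \in nbs Z) && (j \in nbs Z).
    move=> yj ij; have [v [vR iv jv]] := deg5_pair mc y5 yi yj ij.
    rewrite -XY in vR; case: (cov v vR) => [vZ|vZ'].
      by apply/andP; split; apply/nbsP; exists v; rewrite // sedge_sym.
    by case/nbsP: iZ'; exists v; rewrite // sedge_sym.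
  have /set0Pn[j /setD1P[ji yj]] : nb y :\ i != set0.
    by rewrite -card_gt0; have := cardsD1 i (nb y); rewrite yi; nlia.
  apply/subsetP => u yu; case: (eqVneq i u) => [<-|iu].
    rewrite eq_sym in ji; by case/andP: (onZ j yj ji).
  by case/andP: (onZ u yu iu).
have covXY v : v \in X :|: Y -> v \in X \/ v \in Y by move/setUP.
have covYX v : v \in X :|: Y -> v \in Y \/ v \in X by case/setUP; [right|left].
case: (boolP (nb y \subset nbs X)) => sX.
  left; split=> //; move: l7; rewrite (setIidPl sX); nlia.
right; have sY := full _ _ covYX sX; split=> //.
move: l7; rewrite (setIidPl sY); nlia.
Qed.

(* Contracting the complement of K in G - N[y] onto b makes b and the neighbours
   of K in nb y a clique, so that cut_arith applies with k <= 3. *)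
Lemma deg5_cutvertex (G : sgraph) (y b : G) (K : {set G}) : mincex G -> #|nb y| = 5 ->
  conn K -> K \subset ~: (y |: nb y) -> b \in ~: (y |: nb y) :\: K ->
  conn (~: (y |: nb y) :\: K) -> b \in nbs K ->
  nbs K \subset b |: (K :|: nb y) -> #|nb y :&: nbs K| <= 2 ->
  nb y \subset nbs (~: (y |: nb y) :\: K) -> False.
Proof.
move=> mc y5; set R := ~: (y |: nb y) => cK KR bRK cZ bK nK l2 AZ.
have n10 := mc_n10 mc; have [_ lo hi _] := mc.
have [sE n_even] := deg5_dsum_eq mc y5.
have /setDP[bR bnK] := bRK; have bA : b \notin y |: nb y by rewrite inE in bR.
pose L := nb y :&: nbs K; pose S := b |: L.
have bL : b \notin L by apply: contra bA => /setIP[yb _]; rewrite setU1r.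
have cS : #|S| = #|L|.+1 by rewrite cardsU1 bL.
have dKA : [disjoint K & y |: nb y] by rewrite disjoints_subset.
have dKS : [disjoint K & S].
  by rewrite disjointsU1 bnK; apply: disjointWr dKA; rewrite subsetU // subsetIl orbT.
have KS x : x \in K -> nb x \subset K :|: S.
  move=> xK; apply/subsetP => z xz; have zn : z \in nbs K.
    by apply/nbsP; exists x => //; rewrite inE in xz.
  have := subsetP nK _ zn; rewrite in_setU1 in_setU => /or3P[/eqP->|zK|yz].
  - by rewrite in_setU setU11 orbT.
  - by rewrite inE zK.
  - by rewrite in_setU setU1r ?orbT // in_setI yz.
have cutE := dsum_cut dKS KS.
have Lcl : dsum L = #|L| * #|L|.-1.
  apply: dsum_clique => u v /setIP[yu _] /setIP[yv _].
  by apply: (deg5_clique mc y5); rewrite setU1r.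
have n1E : #|K :|: S| = #|K| + #|S| by rewrite -cardsUI (disjoint_setI0 dKS) cards0 addn0.
have n2E : #|K| + #|~: K| = #|G| by rewrite cardsC.
have [K0 _] := cK; have /set0Pn[x xK] := K0; rewrite -card_gt0 in K0.
have n16 : 6 <= #|K :|: S|.
  apply: leq_trans (_ : #|x |: nb x| <= _).
    by rewrite card_nbU1 ltnS mc_deg5.
  by apply: subset_leq_card; rewrite subUset sub1set inE xK KS.
have n27 : 7 <= #|~: K|.
  apply: leq_trans (_ : #|b |: (y |: nb y)| <= _).
    by rewrite cardsU1 card_nbU1 y5 bA.
  apply: subset_leq_card; rewrite subUset sub1set inE bnK /=.
  by rewrite -disjoints_subset disjoint_sym.
have yKS : y \notin K :|: S.
  rewrite inE negb_or (disjointFl dKA) ?setU11 //= in_setU1 negb_or in_setI inE sedge_irr andbT.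
  by apply: contraNneq bA => <-; rewrite setU11.
have nG : #|K :|: S| < #|G|.
  have := max_card (mem (y |: (K :|: S))); rewrite cardsU1 yKS; nlia.
pose Q := L :\: nb b.
have r : rooted (K :|: S) b (R :\: K) Q.
  split=> //.
  - apply/setP => z; rewrite in_setI in_setU in_set1.
    case: (eqVneq z b) => [->|zb]; first by rewrite bRK setU11 orbT.
    apply/negP => /andP[/setDP[zR zK]]; rewrite (negbTE zK) in_setU1 (negbTE zb) /=.
    by case/setIP => yz _; rewrite inE in zR; case/negP: zR; rewrite setU1r.
  - apply/subsetP => z /setDP[zL _]; by rewrite in_setU setU1r ?orbT.
  - by rewrite in_setD (negbTE bL) andbF.
  - move=> q /setDP[/setIP[yq _] bq]; split; first by rewrite inE in bq.
    exact: (subsetP AZ).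
(* [Q] collects the non-neighbours of [b] in the clique [L], so the edges gained at [b] complete [S]
   to a clique. *)
have cSE : dsum S + #|Q|.*2 = #|S| * #|S|.-1.
  rewrite cS /= dsumU1 // Lcl.
  have := cardsID (nb b) L; rewrite -/Q [L :&: nb b]setIC => lE.
  rewrite -mul_pred_double; move: lE; move: (_ * _) => p; nlia.
have Ks : nbs K :&: ~: K = S.
  apply/setP => z; rewrite in_setI in_setU1 in_setI.
  case: (boolP (z \in nbs K)) => [/nbsP[u uK uz]|zn] /=; last first.
    by rewrite andbF orbF; apply/esym; apply: contraNF zn => /eqP->.
  have := subsetP (KS _ uK) z; rewrite inE => /(_ uz).
  rewrite inE in_setU1 in_setI => /orP[zK|].
    rewrite inE zK; move: (disjointFr dKS zK); rewrite in_setU1 in_setI => /norP[/negbTE-> /=].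
    have -> // : z \in nbs K by apply/nbsP; exists u.
    by move=> /negbTE.
  move=> /orP[/eqP->|/andP[yz _]]; first by rewrite eqxx inE bnK.
  by rewrite yz orbT inE (disjointFl dKA) // setU1r.
apply: (@cut_arith #|G| #|K :|: S| #|~: K| #|S| (dsum [set: G])
   (dsum (K :|: S) + #|Q|.*2) (dsum (~: K))) => //.
- by rewrite cS ltnS; apply: leq_trans l2 _.
- nlia.
- by rewrite -cSE; nlia.
- by move=> n8; apply: (mc_contract1 mc r).
- move=> n8; apply: mc_sub => //; nlia.
- by apply: (contract1_le r); nlia.
- exact: dsum_le.
- by move=> _; rewrite cS => k4; move: l2; rewrite -/L; nlia.
- move=> n27'.
  have := mc_attach mc cK (_ : [disjoint K & ~: K]).
  rewrite Ks n27' -setI_eq0 setICr => /(_ (eqxx _) isT); nlia.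
- by rewrite oddD odd_double dsum_even.
- exact: dsum_even.
Qed.

Lemma setUD_sub (T : finType) (X R : {set T}) : X \subset R -> X :|: (R :\: X) = R.
Proof. by move=> XR; rewrite -{1}(setIidPr XR) setID. Qed.

Lemma disjoint_setD (T : finType) (X R : {set T}) : [disjoint X & R :\: X].
Proof. by rewrite -setI_eq0 setDE setICA setICr setI0. Qed.

(** Within [Y] the removed component has no outside neighbour except [b], so everything else stays
    joined to [b]. *)
Lemma conn_setD_component (G : sgraph) (Y : {set G}) b d : conn Y -> b \in Y ->
  d \in Y :\ b -> conn (Y :\: component (Y :\ b) d).
Proof.
move=> cY bY dZ; set C := component _ d; have CZ : C \subset Y :\ b by apply: component_sub.
have bYC : b \in Y :\: C.
  by rewrite in_setD bY andbT; apply/negP => /(subsetP CZ); rewrite in_setD1 eqxx.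
have EY := component_sub bYC.
suff <- : component (Y :\: C) b = Y :\: C by apply: component_conn.
apply/eqP; rewrite eqEsubset EY /=.
have YEC : Y \subset component (Y :\: C) b :|: C.
  apply: (conn_sub cY _ bY); last by rewrite inE component_self.
  move=> u v /setUP[uE|uC] uY vY uv; rewrite in_setU.
    case: (boolP (v \in C)) => vC; rewrite ?orbT ?orbF //.
    by apply: (component_closed uE (subsetP EY _ uE) _ uv); rewrite in_setD vC.
  case: (eqVneq v b) => [->|vb]; first by rewrite component_self.
  apply/orP; right; apply: (component_closed uC (subsetP CZ _ uC) _ uv).
  by rewrite in_setD1 vb.
by apply/subsetP => z /setDP[zY zC]; have := subsetP YEC _ zY; rewrite in_setU (negbTE zC) orbF.
Qed.

(** Take [X] maximal with [P], a vertex [b] of [Y] adjacent to [X], and a component [C] of [Y :\ b].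
    By maximality and [deg5_split], [C] has at most two neighbours in [A] and no neighbour in [X],
    so [deg5_cutvertex] applies to [C] and [b]. If [Y] is just [b], it applies to [X] instead. *)
Lemma mc_no_deg5 (G : sgraph) (y : G) : mincex G -> #|nb y| <> 5.
Proof.
move=> mc y5; set A := nb y; set R := ~: (y |: A).
have n10 := mc_n10 mc; have cR := deg5_conn mc y5; rewrite -/A -/R in cR.
have cRd : 4 <= #|R| by have := cardsC (y |: A); rewrite card_nbU1 y5 -/R; nlia.
pose P (X : {set G}) := [/\ X \subset R, X = set0 \/ conn X, conn (R :\: X)
  & #|A :&: nbs X| <= 2].
have split X : conn X -> conn (R :\: X) -> X \subset R ->
   (A \subset nbs X /\ #|A :&: nbs (R :\: X)| <= 2) \/
   (A \subset nbs (R :\: X) /\ #|A :&: nbs X| <= 2).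
  move=> cX cRX XR; apply: (deg5_split mc y5) => //.
    exact: disjoint_setD.
  exact: setUD_sub.
have [X [PX maxX]] : exists X, P X /\ forall X', P X' -> #|X'| <= #|X|.
  have P0 : P set0.
    split; rewrite ?sub0set ?setD0 //; first by left.
    rewrite (_ : nbs set0 = set0) ?setI0 ?cards0 //.
    by apply/setP => z; rewrite in_set0; apply/negP => /nbsP[u]; rewrite in_set0.
  have bd X : P X -> #|X| <= #|G| by move=> _; apply: max_card.
  (* [P] involves [conn], which is not boolean, so a maximal set is found classically, with orders
     bounded by [#|G|]. *)
  have step m : (exists X, P X /\ forall X', P X' -> #|X'| <= #|X|) \/
                (exists2 X, P X & m <= #|X|).
    elim: m => [|m [|[X PX mX]]]; [by right; exists set0 | by left |].
    case: (Classical_Prop.classic (exists2 X', P X' & m < #|X'|)) => [|n]; first by right.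
    left; exists X; split=> // X' PX'; rewrite leqNgt; apply/negP => lt.
    by apply: n; exists X'; rewrite // (leq_ltn_trans mX).
  case: (step #|G|.+1) => // -[X PX lt]; by have := bd _ PX; rewrite leqNgt lt.
have [XR X0 cY lX] := PX; set Y := R :\: X in cY.
have dXY : [disjoint X & Y] by apply: disjoint_setD.
have XY : X :|: Y = R by apply: setUD_sub.
have [b bY bX] : exists2 b, b \in Y & X = set0 \/ b \in nbs X.
  have [/set0Pn[b0 b0Y] _] := cY.
  case: X0 => [->|cX]; first by exists b0 => //; left.
  have [/set0Pn[x0 x0X] _] := cX.
  case: (boolP [exists b in Y, b \in nbs X]) => [/exists_inP[b bY bX]|/exists_inPn n].
    by exists b => //; right.
  have /subsetP/(_ b0) : R \subset X.
    apply: (conn_sub cR _ (x0 := x0)) => //; last exact: (subsetP XR).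
    move=> u v uX _; rewrite -XY => /setUP[] // vY uv.
    by case/nbsP: (n v vY); exists u.
  by rewrite (disjointFl dXY b0Y) -XY inE b0Y orbT => /(_ isT).
have bR : b \in R by rewrite -XY inE bY orbT.
have nbsU Z Z' : nbs (Z :|: Z') = nbs Z :|: nbs Z'.
  apply/setP => z; rewrite in_setU; apply/nbsP/orP.
    by case=> u /setUP[] uZ uz; [left|right]; apply/nbsP; exists u.
  by case=> /nbsP[u uZ uz]; exists u; rewrite // inE uZ ?orbT.
have nbsR (Z : {set G}) z : Z \subset R -> z \in nbs Z -> z \in R \/ z \in A.
  move=> /subsetP ZR /nbsP[u /ZR uR uz]; case: (boolP (z \in R)) => zR; [by left|right].
  rewrite inE negbK in zR; case/setU1P: zR => // zy.
  by move: uR; rewrite !inE -zy [z -- u]sedge_sym uz orbT.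
case: (eqVneq Y [set b]) => [Yb|Yb].
  have nX0 : X <> set0.
    by move=> X0'; rewrite -XY X0' set0U Yb cards1 in cRd.
  have cX : conn X by case: X0.
  have bnX : b \in nbs X by case: bX.
  apply: (@deg5_cutvertex _ y b X) => //.
  - apply/subsetP => z zX; case: (nbsR _ _ XR zX) => [|zA]; last by rewrite !in_setU zA !orbT.
    by rewrite -XY Yb !inE => /orP[->|->]; rewrite ?orbT.
  - case: (split X cX cY XR) => [[sX _]|[]] //.
    by move: lX; rewrite (setIidPl sX) y5.
pose Z := Y :\ b.
have /set0Pn[d dZ] : Z != set0.
  apply: contra Yb => /eqP Z0; rewrite eqEsubset sub1set bY andbT.
  apply/subsetP => z zY; rewrite inE; apply: contraT => zb.
  by have : z \in Z; [rewrite in_setD1 zb | rewrite Z0 inE].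
pose C := component Z d.
have CZ : C \subset Z by apply: component_sub.
have bC : b \notin C by apply/negP => /(subsetP CZ); rewrite in_setD1 eqxx.
have CY : C \subset Y by apply: subset_trans CZ (subsetDl _ _).
have YR : Y \subset R by rewrite -XY subsetUr.
have CR : C \subset R by apply: subset_trans CY YR.
have cC : conn C by apply: component_conn.
have cYC : conn (Y :\: C) by apply: conn_setD_component.
have dC : d \in C by apply: component_self.
have RXC : R :\: (X :|: C) = Y :\: C by rewrite setDDl.
have dXC : [disjoint C & X] by rewrite disjoint_sym; apply: disjointWr dXY.
have RC : R :\: C = X :|: (Y :\: C).
  rewrite -{1}XY setDUl; congr (_ :|: _).
  by apply/setDidPl; rewrite disjoint_sym.
have bYC : b \in Y :\: C by rewrite in_setD bC.
have cRC : conn (R :\: C).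
  rewrite RC; case: bX => [->|/nbsP[x xX xb]]; first by rewrite set0U.
  case: X0 => [X0|cX]; first by rewrite X0 inE in xX.
  by apply: (connU cX cYC xX bYC); rewrite xb orbT.
have cardXb : #|X| < #|R :\: C|.
  rewrite RC; apply: proper_card; apply/properP; split; first exact: subsetUl.
  by exists b; rewrite ?(disjointFl dXY) // in_setU bYC orbT.
(* [R :\: C] contains [X] and also [b], so by maximality it cannot have only two neighbours in
   [A]. *)
case: (split C cC cRC CR) => [[_ lRC]|[ARC lC]].
  have /maxX : P (R :\: C); last by rewrite leqNgt cardXb.
  split; [exact: subsetDl|by right| |by []].
  by rewrite setDDr setDv set0U (setIidPr CR).
have XCR : X :|: C \subset R by rewrite subUset XR.
(* If [X :|: C] were connected, it would contradict maximality or see five vertices of [A] with only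
   2 + 2 available. *)
have nocon : conn (X :|: C) -> False.
  move=> cXC; have cRXC : conn (R :\: (X :|: C)) by rewrite RXC.
  case: (split _ cXC cRXC XCR) => [[AXC _]|[_ lXC]].
    have : #|A :&: nbs (X :|: C)| <= #|A :&: nbs X| + #|A :&: nbs C|.
      by rewrite nbsU setIUr -cardsUI leq_addr.
    by rewrite (setIidPl AXC) y5; move: lX lC; clear; lia.
  have /maxX : P (X :|: C) by split=> //; right.
  rewrite leqNgt proper_card //; apply/properP; split; first exact: subsetUl.
  by exists d; rewrite ?(disjointFr dXC) // in_setU dC orbT.
have [cX nXC] : conn X /\ forall u, u \in C -> u \notin nbs X.
  case: X0 => [X0|cX]; first by case: nocon; rewrite X0 set0U.
  split=> // u uC; apply/negP => /nbsP[x xX xu]; case: nocon.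
  by apply: (connU cX cC xX uC); rewrite xu orbT.
apply: (@deg5_cutvertex _ y b C) => //.
- by rewrite in_setD bC.
- apply/nbsP; case: (boolP [exists u in C, u -- b]) => [/exists_inP[u]|/exists_inPn n].
    by exists u.
  case/negP: bC; apply: (subsetP (conn_sub cY _ (subsetP CY _ dC) dC)) => //.
  move=> u v uC _ vY uv; apply: (component_closed uC (subsetP CZ _ uC) _ uv).
  by rewrite in_setD1 vY andbT; apply: contraTneq uv => ->; apply: n.
- apply/subsetP => z zC; case: (nbsR _ _ CR zC) => [|zA]; last by rewrite !in_setU zA !orbT.
  rewrite in_setU1 in_setU -XY => /setUP[zX|zY].
    by case/nbsP: zC => u uC uz; case/nbsP: (nXC u uC); exists z; rewrite // sedge_sym.
  case: eqVneq => //= zb; case: (component_nbs dZ zC) => [->//|].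
  by rewrite in_setD1 zb zY.
Qed.

(** * Neighbourhoods of vertices of degree six, seven and eight *)

Definition co_rel (G : sgraph) : rel G := fun x y => (x != y) && ~~ (x -- y).

Lemma co_sym (G : sgraph) : symmetric (@co_rel G).
Proof. by move=> x y; rewrite /co_rel eq_sym sedge_sym. Qed.

Lemma co_irr (G : sgraph) : irreflexive (@co_rel G).
Proof. by move=> x; rewrite /co_rel eqxx. Qed.

Definition co (G : sgraph) : sgraph := SGraph (@co_sym G) (@co_irr G).

Definition cn (G : sgraph) (w : G) : {set G} := @nb (co G) w.

(** Twice the number of missing edges. On eight vertices, degree sum at least 48 means a value of at
    most 8, so contracted graphs of that order must reach 9. *)
Definition cdsum (G : sgraph) (W : {set G}) : nat := @dsum (co G) W.

Lemma in_cn (G : sgraph) (w y : G) : (y \in cn w) = (w != y) && ~~ (w -- y).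
Proof. by rewrite inE. Qed.

Lemma cn_sym (G : sgraph) (w y : G) : (y \in cn w) = (w \in cn y).
Proof. by rewrite !in_cn eq_sym sedge_sym. Qed.

Lemma card_nb_cn (G : sgraph) (W : {set G}) x : x \in W ->
  #|nb x :&: W| + #|cn x :&: W| + 1 = #|W|.
Proof.
move=> xW; rewrite [RHS](cardsD1 x) xW -(cardsID (nb x) (W :\ x)).
have -> : (W :\ x) :&: nb x = nb x :&: W.
  apply/setP => y; rewrite !inE; case: eqVneq => [->|_] /=; last by rewrite andbC.
  by rewrite sedge_irr.
have -> : (W :\ x) :\: nb x = cn x :&: W.
  by apply/setP => y; rewrite in_setI in_cn !inE eq_sym andbCA andbA.
by rewrite addn1 add1n.
Qed.

Lemma dsum_co (G : sgraph) (W : {set G}) : dsum W + cdsum W = #|W| * #|W|.-1.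
Proof.
rewrite /cdsum /dsum -big_split -sum_nat_const; apply: eq_bigr => x xW.
by have <- := card_nb_cn xW; rewrite addn1.
Qed.

Lemma cn_le (G : sgraph) (z w : G) : mincex G -> w \in nb z ->
  #|cn w :&: nb z| + 5 <= #|nb z|.
Proof.
move=> mc zw; have := card_nb_cn zw; have zw' : z -- w by rewrite inE in zw.
have := mc_common mc zw'; rewrite setIC; nlia.
Qed.

Lemma cn_self (G : sgraph) (z w : G) : w \in cn z -> w \in nb z = false.
Proof. by rewrite in_cn inE => /andP[_ /negbTE]. Qed.

Lemma cn_nb0 (G : sgraph) (z : G) (W : {set G}) : W \subset nb z -> cn z :&: W = set0.
Proof.
move=> Wz; apply/setP => y; rewrite in_setI in_set0; apply/negP => /andP[/cn_self zy].
by move/(subsetP Wz); rewrite zy.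
Qed.

(** Inclusion together with the comparison of degrees forces equal closed neighbourhoods. *)
Lemma cn_nested (G : sgraph) (z w : G) : w \in nb z -> nb w \subset z |: nb z ->
  #|nb z| <= #|nb w| -> cn w :&: nb z = set0.
Proof.
move=> zw sub le; apply/setP => y; rewrite in_setI in_set0; apply/negP => /andP[wy zy].
have : nb w \subset (z |: nb z) :\ w :\ y.
  apply/subsetP => x wx; rewrite !in_setD1 (subsetP sub _ wx) andbT.
  move: wx wy; rewrite inE in_cn => wx /andP[_ wy].
  by apply/andP; split; [apply: contraNneq wy => <- | apply: contraTneq wx => ->; rewrite sedge_irr].
move/subset_leq_card; have := cardsD1 w (z |: nb z); have := cardsD1 y ((z |: nb z) :\ w).
rewrite in_setD1 !setU1r // andbT card_nbU1.
have -> : y != w by apply: contraTneq wy => ->; rewrite in_cn eqxx.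
by move: le; clear; lia.
Qed.

(* D sees every vertex of nb z that is not adjacent to all of nb z, so it may
   serve as an extra branch set or be absorbed by any such vertex. *)
Definition attached (G : sgraph) (z : G) (D : {set G}) : Prop :=
  [/\ conn D, [disjoint D & z |: nb z]
    & forall w, w \in nb z -> w \notin nbs D -> cn w :&: nb z = set0].

Lemma attached_nbs (G : sgraph) (z : G) (D : {set G}) w q : attached z D ->
  w \in nb z -> q \in cn w -> q \in nb z -> q \in nbs D.
Proof.
move=> [_ _ h] zw wq zq; apply: contraT => /(h q zq)/setP/(_ w).
by rewrite in_setI in_set0 cn_sym wq zw.
Qed.

(** If [D] sees [w], then [w |: D] works, since [D] sees each vertex of [nb z] having a
    non-neighbour there. Otherwise [w] has no non-neighbour in [nb z] and is enough alone. *)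
Lemma attached_absorb (G : sgraph) (z : G) (D : {set G}) w : attached z D -> w \in nb z ->
  exists Z, [/\ conn Z, w \in Z, Z \subset w |: D
    & forall q, q \in cn w -> q \in nb z -> q \in nbs Z].
Proof.
move=> loc zw; have [cD _ h] := loc; case: (boolP (w \in nbs D)) => wD.
  exists (w |: D); split; rewrite ?setU11 //.
    case/nbsP: wD => x xD xw.
    by apply: (connU (conn1 w) cD _ xD); rewrite ?inE // sedge_sym xw orbT.
  move=> q wq zq; have /nbsP[x xD xq] := attached_nbs loc zw wq zq.
  by apply/nbsP; exists x; rewrite // setU1r.
exists [set w]; split; rewrite ?subsetUl ?set11 //; first exact: conn1.
by move=> q wq zq; have /setP/(_ q) := h w zw wD; rewrite in_setI wq zq in_set0.
Qed.

Lemma mc_win2 (G : sgraph) (W : {set G}) a Z Q a' Z' Q' :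
  mincex G -> rooted W a Z Q -> rooted W a' Z' Q' -> [disjoint Z & Z'] -> a' \notin Q ->
  #|W| = 8 -> 9 + #|Q|.*2 + #|Q'|.*2 <= cdsum W.
Proof.
move=> mc r r' dZ aQ w8; have [n9 _ _ _] := mc.
have := mc_contract2 mc r r' dZ aQ; have := dsum_co W; rewrite w8; nlia.
Qed.

Lemma mc_win1 (G : sgraph) (W : {set G}) a Z Q :
  mincex G -> rooted W a Z Q -> #|W| = 8 -> 9 + #|Q|.*2 <= cdsum W.
Proof.
move=> mc r w8; have [n9 _ _ _] := mc.
have := mc_contract1 mc r; have := dsum_co W; rewrite w8; nlia.
Qed.

Lemma mc_win (G : sgraph) (W : {set G}) : mincex G -> #|W| = 8 -> 9 <= cdsum W.
Proof.
move=> mc w8; have [n9 _ _ _] := mc.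
have := mc_sub mc; have := dsum_co W; rewrite w8 => + /(_ W); rewrite w8; nlia.
Qed.

Lemma cdsumU1 (G : sgraph) (W : {set G}) v : v \notin W ->
  cdsum (v |: W) = cdsum W + #|cn v :&: W|.*2.
Proof. exact: (@dsumU1 (co G)). Qed.

Lemma cdsumD1 (G : sgraph) (W : {set G}) v : v \in W ->
  cdsum W = cdsum (W :\ v) + #|cn v :&: W|.*2.
Proof. exact: (@dsumD1 (co G)). Qed.

Lemma cdsumE (G : sgraph) (W : {set G}) : cdsum W = \sum_(w in W) #|cn w :&: W|.
Proof. by []. Qed.

Lemma cdsum_even (G : sgraph) (W : {set G}) : odd (cdsum W) = false.
Proof. exact: (@dsum_even (co G)). Qed.

Lemma cdsum_closed_nb (G : sgraph) (z : G) : cdsum (z |: nb z) = cdsum (nb z).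
Proof.
rewrite cdsumU1; last by rewrite inE sedge_irr.
by rewrite cn_nb0 // cards0 addn0.
Qed.

(** The closed neighbourhood of [z] has eight vertices, and each vertex of [nb z] misses at most two
    others. Absorbing [D] into a vertex repairs all its missing pairs, which forces each vertex to
    miss exactly two; a different contraction then settles this regular case. *)
Lemma attached_deg7 (G : sgraph) (z : G) (D : {set G}) :
  mincex G -> attached z D -> #|nb z| <> 7.
Proof.
move=> mc loc d7; have [cD dD hD] := loc; have n10 := mc_n10 mc.
have zz : z \notin nb z by rewrite inE sedge_irr.
have W8 : #|z |: nb z| = 8 by rewrite card_nbU1 d7.
have hle w : w \in nb z -> #|cn w :&: nb z| <= 2.
  by move=> zw; have := cn_le mc zw; rewrite d7; nlia.
set S := cdsum (nb z).
have SE : S = \sum_(w in nb z) #|cn w :&: nb z| by [].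
have Sev : odd S = false by apply: cdsum_even.
have abs w : w \in nb z -> 9 + #|cn w :&: nb z|.*2 <= S.
  move=> zw; have [Z [cZ wZ ZD qZ]] := attached_absorb loc zw.
  rewrite /S -cdsum_closed_nb; apply: (mc_win1 (a := w) (Z := Z) mc _ W8).
  split=> //.
  - apply/setP => y; rewrite in_setI in_set1; case: eqVneq => [->|yw].
      by rewrite wZ setU1r.
    apply/negP => /andP[/(subsetP ZD)]; rewrite in_setU1 (negbTE yw) /= => yD.
    by rewrite (disjointFr dD yD).
  - by apply/subsetP => y /setIP[_ zy]; rewrite setU1r.
  - by rewrite in_setI in_cn eqxx.
  - move=> q /setIP[wq zq]; split; last exact: qZ.
    by move: wq; rewrite in_cn => /andP[].
have S9 : 9 <= S by rewrite /S -cdsum_closed_nb; apply: mc_win.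
(* Some vertex misses two others, since one each gives at most 7; absorbing [D] there lowers [S] by
   4, and at least 9 must remain. *)
have S13 : 13 <= S.
  have [[w zw w2]|n] : (exists2 w, w \in nb z & 2 <= #|cn w :&: nb z|) \/
      forall w, w \in nb z -> #|cn w :&: nb z| <= 1.
    case: (boolP [exists w in nb z, 2 <= #|cn w :&: nb z|]).
      by move=> /exists_inP[w zw w2]; left; exists w.
    by move=> /exists_inPn n; right=> w zw; have := n w zw; rewrite -ltnNge.
    by have := abs w zw; nlia.
  have : S <= \sum_(w in nb z) 1 by rewrite SE; apply: leq_sum.
  by rewrite sum1_card d7; nlia.
have all2 w : w \in nb z -> #|cn w :&: nb z| = 2.
  move=> zw; apply/eqP; rewrite eqn_leq hle //.
  have : S <= #|cn w :&: nb z| + \sum_(v in nb z :\ w) 2.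
    rewrite SE (big_setD1 w) //= leq_add2l.
    by apply: leq_sum => v /setD1P[_ zv]; apply: hle.
  by rewrite sum_nat_const; have := cardsD1 w (nb z); rewrite zw d7; nlia.
have S14 : S = 14.
  by rewrite SE (eq_bigr (fun _ => 2)) // sum_nat_const d7.
have [u zu] : exists u, u \in nb z by apply/set0Pn; rewrite -card_gt0 d7.
(* The non-adjacency graph is 2-regular on the seven vertices of nb z, so some v
   is at distance at least 3 from u in it; merge u and v and keep D as a vertex. *)
pose bad := u |: (cn u :&: nb z) :|: \bigcup_(a in cn u :&: nb z) (cn a :&: nb z :\ u).
have badle : #|bad| <= 5.
  apply: leq_trans (leq_card_setU _ _) _; rewrite cardsU1 in_setI in_cn eqxx /= all2 //.
  suff : #|\bigcup_(a in cn u :&: nb z) (cn a :&: nb z :\ u)| <= 2 by nlia.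
  apply: leq_trans (_ : \sum_(a in cn u :&: nb z) 1 <= 2); last by rewrite sum1_card all2.
  apply: leq_trans (_ : \sum_(a in cn u :&: nb z) #|cn a :&: nb z :\ u| <= _).
    elim/big_rec2: _ => [|a A k _ le]; first by rewrite cards0.
    by apply: leq_trans (leq_card_setU _ _) _; rewrite leq_add2l.
  apply: leq_sum => a /setIP[ua za]; have := cardsD1 u (cn a :&: nb z).
  by rewrite all2 // in_setI zu cn_sym ua /=; nlia.
have /set0Pn[v /setDP[zv vbad]] : nb z :\: bad != set0.
  rewrite -card_gt0 cardsD; have := subset_leq_card (subsetIr (nb z) bad).
  by rewrite d7; nlia.
have [vu vnu vfar] : [/\ v != u, v \notin cn u & forall a, a \in cn u -> a \in nb z -> a \notin cn v].
  move: vbad; rewrite !in_setU in_set1 in_setI zv andbT !negb_or -andbA => /and3P[vu vnu /bigcupP n].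
  split=> // a ua za; apply/negP => av; apply: n; exists a; first by rewrite in_setI ua.
  by rewrite in_setD1 vu in_setI cn_sym av.
have uv : u -- v by apply: contraNT vnu => nuv; rewrite in_cn eq_sym vu.
pose W0 := z |: (nb z :\ v).
have zW0 : z \notin nb z :\ v by rewrite in_setD1 (negbTE zz) andbF.
have [/set0Pn[x xD] _] := cD.
have xN : x \notin z |: nb z by rewrite (disjointFr dD xD).
have W0N : W0 \subset z |: nb z by rewrite setUS // subsetDl.
have xW0 : x \notin W0 by apply: contra xN; apply: (subsetP W0N).
have cW0 : #|W0| = 7.
  by rewrite cardsU1 zW0; have := cardsD1 v (nb z); rewrite zv d7; nlia.
have dW0 : dsum W0 = 32.
  have := dsum_co W0; rewrite cW0 cdsumU1 // cn_nb0 ?subsetDl // cards0 addn0.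
  by have := cdsumD1 zv; rewrite all2 // -/S S14; nlia.
have vW0 : v \notin W0.
  by rewrite in_setU1 in_setD1 eqxx orbF; apply: contraTneq zv => ->.
have vx : v != x by apply: contraNneq xN => <-; rewrite setU1r.
have uW0 : u \in W0 by rewrite setU1r // in_setD1 eq_sym vu.
have r1 : rooted (x |: W0) u [set u; v] (cn u :&: nb z).
  split.
  - by apply: (connU (conn1 u) (conn1 v) (set11 u) (set11 v)); rewrite uv orbT.
  - apply/setP => y; rewrite in_setI in_set2 in_set1 in_setU1.
    case: eqVneq => [->|yu] /=; first by rewrite uW0 orbT.
    by case: eqVneq => //= ->; rewrite (negbTE vx) (negbTE vW0).
  - apply/subsetP => q /setIP[uq zq]; rewrite !setU1r // in_setD1 zq andbT.
    by apply: contraNneq vnu => <-.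
  - by rewrite in_setI in_cn eqxx.
  - move=> q /setIP[uq zq]; split; first by move: uq; rewrite in_cn => /andP[].
    apply/nbsP; exists v; first by rewrite !inE eqxx orbT.
    have := vfar q uq zq; rewrite cn_sym in_cn negb_and !negbK => /orP[/eqP qv|//].
      by rewrite -qv uq in vnu.
    by rewrite sedge_sym.
have r2 : rooted (x |: W0) x D ((nbs D :&: W0) :\: nb x :\ x).
  apply: rooted_attach => //; rewrite ?subsetUr ?setU11 // setU1K //.
  exact: disjointWr dD.
have dZ : [disjoint [set u; v] & D].
  have nD y : y \in nb z -> y \notin D by move=> zy; rewrite (disjointFl dD) // setU1r.
  by rewrite disjoint_sym disjointsU1 nD // disjoint_sym disjoints1 nD.
have xQ : x \notin cn u :&: nb z.
  by apply: contra xN => /setIP[_ zx]; rewrite setU1r.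
(* [W0] contributes 32, the two pairs gained by [u] contribute 4, and [D], which sees all six
   vertices of [nb z :\ v], contributes 12: the total is 48. *)
have := mc_contract2 mc r1 r2 dZ xQ.
rewrite cardsU1 xW0 cW0 dsumU1 // dW0 all2 // => /(_ isT) h.
have := card_attach xD xW0.
have : 6 <= #|nbs D :&: W0|.
  have -> : 6 = #|nb z :\ v| by have := cardsD1 v (nb z); rewrite zv d7; nlia.
  apply: subset_leq_card; rewrite subsetI subsetUr andbT.
  apply/subsetP => y /setD1P[_ zy].
  have /set0Pn[a /setIP[ya za]] : cn y :&: nb z != set0 by rewrite -card_gt0 all2.
  by apply: (attached_nbs loc za) => //; rewrite cn_sym.
have := h (ltnW n10); move: (#|_ :\ x|) (#|nb x :&: W0|) (#|nbs D :&: W0|); clear; lia.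
Qed.

(** Here [i] is [cdsum N], each [c] counts the non-neighbours in [N] of one of the four vertices of
    [R], and each [e] marks a non-adjacent pair in [R]. The last twelve inequalities are [deg8_step]
    for all choices of [w] and [v] in [R]. *)
Lemma deg8_arith (i c1 c2 c3 c4 : nat) (e12 e13 e14 e23 e24 e34 : bool) :
  odd i = false ->
  i + (c1 + c2 + c3 + c4) <= 6 ->
  c1 + (e12 + e13 + e14) <= 3 -> c2 + (e12 + e23 + e24) <= 3 ->
  c3 + (e13 + e23 + e34) <= 3 -> c4 + (e14 + e24 + e34) <= 3 ->
  9 <= i + (c2 + c3 + c4 + e23).*2 -> 9 <= i + (c2 + c3 + c4 + e24).*2 ->
  9 <= i + (c2 + c3 + c4 + e34).*2 ->
  9 <= i + (c1 + c3 + c4 + e13).*2 -> 9 <= i + (c1 + c3 + c4 + e14).*2 ->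
  9 <= i + (c1 + c3 + c4 + e34).*2 ->
  9 <= i + (c1 + c2 + c4 + e12).*2 -> 9 <= i + (c1 + c2 + c4 + e14).*2 ->
  9 <= i + (c1 + c2 + c4 + e24).*2 ->
  9 <= i + (c1 + c2 + c3 + e12).*2 -> 9 <= i + (c1 + c2 + c3 + e13).*2 ->
  9 <= i + (c1 + c2 + c3 + e23).*2 -> False.
Proof.
by case: e12; case: e13; case: e14; case: e23; case: e24; case: e34; rewrite ?addn0 /=; lia.
Qed.

Lemma cdsumU (G : sgraph) (A B : {set G}) : [disjoint A & B] ->
  cdsum (A :|: B) = cdsum A + cdsum B + (\sum_(x in B) #|cn x :&: A|).*2.
Proof. by move=> dAB; rewrite /cdsum (@dsumU (co G)) // e2C. Qed.

(* Contract the edge uv and let w absorb D: at least five non-adjacent pairs must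
   remain among the resulting eight branch sets. *)
Lemma deg8_step (G : sgraph) (z u : G) (D N R : {set G}) (w v p q : G) :
  mincex G -> attached z D -> #|nb z| = 8 -> u \in nb z -> N \subset nb z :\ u ->
  cn u :&: nb z \subset N -> R = (nb z :\ u) :\: N -> perm_eq [:: w; v; p; q] (enum R) ->
  9 <= cdsum N + (#|cn v :&: N| + #|cn p :&: N| + #|cn q :&: N| + (q \in cn p)).*2.
Proof.
move=> mc loc d8 zu Nsub uN RE pR; have [cD dD _] := loc.
have memR y : y \in R = (y \in [:: w; v; p; q]) by rewrite (perm_mem pR) mem_enum.
have [[wv wp wq] [vp vq] pq] : [/\ [/\ w != v, w != p & w != q], v != p /\ v != q & p != q].
  have : uniq [:: w; v; p; q] by rewrite (perm_uniq pR) enum_uniq.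
  by rewrite /= !inE !negb_or andbT => /and3P[/and3P[-> -> ->] /andP[-> ->] ->].
have Rz y : y \in R -> [/\ y \in nb z, y != u & y \notin N].
  by rewrite RE => /setDP[/setD1P[yu yz] yN].
have Rcu y : y \in R -> y \notin cn u.
  move=> /Rz[zy _ yN]; apply: contra yN => uy; apply: (subsetP uN).
  by rewrite in_setI uy.
have wR : w \in R by rewrite memR inE eqxx.
have vR : v \in R by rewrite memR !inE eqxx orbT.
have pR' : p \in R by rewrite memR !inE eqxx !orbT.
have qR : q \in R by rewrite memR !inE eqxx !orbT.
have [zw wu wN] := Rz _ wR; have [zv vu vN] := Rz _ vR.
have [zp pu pN] := Rz _ pR'; have [zq qu qN] := Rz _ qR.
have zz : z \notin nb z by rewrite inE sedge_irr.
have uv : u -- v by apply: contraNT (Rcu v vR) => nuv; rewrite in_cn eq_sym vu.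
pose W := z |: (nb z :\ v).
have zW : z \notin nb z :\ v by rewrite in_setD1 (negbTE zz) andbF.
have cW : #|W| = 8 by rewrite cardsU1 zW; have := cardsD1 v (nb z); rewrite zv d8; nlia.
have vW : v \notin W.
  by rewrite in_setU1 in_setD1 eqxx orbF; apply: contraTneq zv => ->.
have uNN : u \notin N by apply/negP => /(subsetP Nsub); rewrite in_setD1 eqxx.
have r1 : rooted W u [set u; v] (cn u :&: nb z :&: nb v).
  split.
  - by apply: (connU (conn1 u) (conn1 v) (set11 u) (set11 v)); rewrite uv orbT.
  - apply/setP => y; rewrite in_setI in_set2 in_set1.
    case: eqVneq => [->|yu] /=; first by rewrite setU1r // in_setD1 eq_sym vu.
    by case: eqVneq => //= ->; rewrite (negbTE vW).
  - apply/subsetP => y /setIP[/setIP[uy zy] vy]; rewrite setU1r // in_setD1 zy andbT.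
    by apply: contraTneq vy => ->; rewrite inE sedge_irr.
  - by rewrite !in_setI in_cn eqxx.
  - move=> y /setIP[/setIP[uy zy] vy]; split; first by move: uy; rewrite in_cn => /andP[].
    by apply/nbsP; exists v; [rewrite !inE eqxx orbT | rewrite inE in vy].
have [Z [cZ wZ ZD nZ]] := attached_absorb loc zw.
have DN y : y \in D -> y \notin nb z.
  by move=> yD; have := disjointFr dD yD; rewrite in_setU1 => /norP[].
have Dz y : y \in D -> y != z.
  by move=> yD; have := disjointFr dD yD; rewrite in_setU1 => /norP[].
have r2 : rooted W w Z (cn w :&: (nb z :\ v)).
  split=> //.
  - apply/setP => y; rewrite in_setI in_set1; case: eqVneq => [->|yw].
      by rewrite wZ setU1r // in_setD1 wv.
    apply/negP => /andP[/(subsetP ZD)]; rewrite in_setU1 (negbTE yw) /= => yD.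
    by rewrite in_setU1 (negbTE (Dz _ yD)) in_setD1 (negbTE (DN _ yD)) andbF.
  - by apply/subsetP => y /setIP[_ zy]; rewrite setU1r.
  - by rewrite in_setI in_cn eqxx.
  - move=> y /setIP[wy /setD1P[_ zy]]; split; last exact: nZ.
    by move: wy; rewrite in_cn => /andP[].
have dZ : [disjoint [set u; v] & Z].
  rewrite disjoint_sym; apply: disjointWl ZD _; rewrite disjointsU1 in_setU1 negb_or eq_sym wu /=.
  rewrite disjoint_sym disjoints1 in_setU1 negb_or eq_sym wv /=.
  by rewrite !(disjointFl dD) // setU1r.
have wQ : w \notin cn u :&: nb z :&: nb v by rewrite !in_setI (negbTE (Rcu _ wR)).
have := mc_win2 mc r1 r2 dZ wQ cW.
have nbE : nb z :\ v = u |: (N :|: (w |: (p |: [set q]))).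
  apply/setP => y; rewrite in_setU1 in_setU !in_setU1 in_set1 in_setD1.
  have := memR y; rewrite RE in_setD in_setD1 !in_cons in_nil orbF.
  case: (eqVneq y u) => [->|yu]; first by rewrite zu andbT [u == v]eq_sym vu.
  case: (boolP (y \in N)) => yN /=.
    have := subsetP Nsub _ yN; rewrite in_setD1 => /andP[_ ->].
    by rewrite (contraNneq _ vN) // => <-.
  move=> ->; case: (eqVneq y v) => [->|_] //=.
  by rewrite [v == w]eq_sym (negbTE wv) (negbTE vp) (negbTE vq).
have dNW : [disjoint N & w |: (p |: [set q])].
  by rewrite !disjointsU1 wN pN disjoint_sym disjoints1.
have wpq : w \notin p |: [set q] by rewrite !inE negb_or wp.
have ppq : p \notin [set q] by rewrite inE.
have uNW : u \notin N :|: (w |: (p |: [set q])).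
  by rewrite in_setU !in_setU1 in_set1 !negb_or uNN eq_sym wu eq_sym pu eq_sym qu.
rewrite /W cdsumU1 // (@cn_nb0 _ z (nb z :\ v)) ?subsetDl // cards0 addn0.
rewrite [in cdsum _]nbE cdsumU1 // cdsumU //.
rewrite cdsumU1 // cdsumU1 // !big_setU1 // big_set1.
rewrite -/(cdsum [set q]).
have -> : cdsum [set q] = 0 by apply: (@dsum1 (co G)).
have -> : #|cn p :&: [set q]| = (q \in cn p) by rewrite card_setI_sum big_set1.
have -> : #|cn u :&: (N :|: (w |: (p |: [set q])))| = #|cn u :&: N|.
  apply: eq_card => y; rewrite !in_setI in_setU.
  case: (boolP (y \in N)) => //= yN; rewrite andbF; apply/negP => /andP[uy].
  by rewrite !in_setU1 in_set1 => /or3P[]/eqP yE; move: uy; rewrite yE; apply/negP; apply: Rcu.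
have -> : #|cn w :&: (nb z :\ v)| = #|cn w :&: N| + #|cn w :&: (p |: [set q])|.
  rewrite nbE -card_setIU_disj; last first.
    by apply: disjointWr dNW; apply: subsetUr.
  apply: eq_card => y; rewrite !in_setI in_setU1 !in_setU !in_set1.
  case: (eqVneq y u) => [->|_] /=.
    by rewrite cn_sym (negbTE (Rcu _ wR)).
  case: (eqVneq y w) => [->|_] //=; by rewrite in_cn eqxx.
(* A non-neighbour of [u] in [N] stays missing after the merge only if it is a non-neighbour of [v]
   too. *)
have : #|cn u :&: N| <= #|cn u :&: nb z :&: nb v| + #|cn v :&: N|.
  apply: leq_trans (leq_card_setU _ _); apply: subset_leq_card.
  apply/subsetP => y /setIP[uy yN]; rewrite in_setU !in_setI uy yN andbT /=.
  have /setD1P[yu zy] := subsetP Nsub _ yN.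
  rewrite zy /= in_cn inE; case: (v -- y) => //=; rewrite andbT.
  by apply: contraNneq vN => ->.
move: (nat_of_bool _) => e /=; nlia.
Qed.

(** Let [u] have the most non-neighbours in [nb z], at most three, all placed in [N]. Apart from
    [u], a vertex of [N] misses at most two others and a vertex of [R] at most three. With so few
    missing pairs, one of the twelve contractions of [deg8_step] must succeed. *)
Lemma attached_deg8 (G : sgraph) (z : G) (D : {set G}) :
  mincex G -> attached z D -> #|nb z| <> 8.
Proof.
move=> mc loc d8.
have hle w : w \in nb z -> #|cn w :&: nb z| <= 3.
  by move=> zw; have := cn_le mc zw; rewrite d8; nlia.
have [u0 zu0] : exists u, u \in nb z by apply/set0Pn; rewrite -card_gt0 d8.
have [u zu umax] : exists2 u, u \in nb z & forall y, y \in nb z -> #|cn y :&: nb z| <= #|cn u :&: nb z|.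
  by case: (@arg_maxnP _ u0 (mem (nb z)) (fun u => #|cn u :&: nb z|) zu0) => u zu umax; exists u.
have uu : cn u :&: nb z \subset nb z :\ u.
  apply/subsetP => y /setIP[uy zy]; rewrite in_setD1 zy andbT.
  by apply: contraTneq uy => ->; rewrite in_cn eqxx.
have c7 : #|nb z :\ u| = 7 by have := cardsD1 u (nb z); rewrite zu d8; nlia.
have [N [uN Nsub cN]] : exists N : {set G}, [/\ cn u :&: nb z \subset N, N \subset nb z :\ u & #|N| = 3].
  by apply: (set_between uu (hle u zu)); rewrite c7.
pose R := (nb z :\ u) :\: N.
have cR : #|R| = 4 by rewrite cardsD (setIidPr Nsub) c7 cN.
have dNR : [disjoint N & R] by apply: disjoint_setD.
have Rz y : y \in R -> y \in nb z by case/setDP => /setD1P[].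
have Nz y : y \in N -> y \in nb z by move/(subsetP Nsub)/setD1P => [].
(* N is a set of three vertices containing the non-neighbours of u; the bound
   holds by the degree bound 3, or by the choice of u when N is padded. *)
have NR_le n : n \in N -> #|cn n :&: N| + #|cn n :&: R| <= 2.
  move=> nN; rewrite -card_setIU_disj //.
  have -> : N :|: R = nb z :\ u by apply: setUD_sub.
  have zn := Nz _ nN; have := hle n zn; have := umax n zn.
  have -> : cn n :&: (nb z :\ u) = (cn n :&: nb z) :\ u by rewrite setIDA.
  have := cardsD1 u (cn n :&: nb z); rewrite in_setI zu andbT cn_sym.
  case: (boolP (n \in cn u)) => un; first by nlia.
  have : #|cn u :&: nb z| < #|N|.
    apply: proper_card; apply/properP; split=> //; exists n => //.
    by rewrite in_setI (negbTE un).
  by rewrite cN; nlia.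
have six : cdsum N + \sum_(r in R) #|cn r :&: N| <= 6.
  rewrite -[\sum_(r in R) _]/(@cross (co G) R N) e2C /cross cdsumE -big_split /=.
  apply: leq_trans (_ : \sum_(n in N) 2 <= 6); last by rewrite sum_nat_const cN.
  exact: leq_sum.
have R_le r : r \in R -> #|cn r :&: N| + #|cn r :&: R| <= 3.
  move=> rR; rewrite -card_setIU_disj //.
  apply: leq_trans (hle r (Rz _ rR)); apply: subset_leq_card.
  apply: setIS; rewrite setUD_sub //; exact: subsetDl.
case E : (enum R) => [|r1 [|r2 [|r3 [|r4 [|]]]]]; move: cR; rewrite cardE E //= => _.
have bigR (F : G -> nat) : \sum_(r in R) F r = F r1 + F r2 + F r3 + F r4.
  by rewrite -big_enum E !big_cons big_nil /= addn0 !addnA.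
have memR r : r \in R = (r \in [:: r1; r2; r3; r4]) by rewrite -E mem_enum.
have cnR r : #|cn r :&: R| = (r1 \in cn r) + (r2 \in cn r) + (r3 \in cn r) + (r4 \in cn r).
  by rewrite card_setI_sum bigR.
have step w v p q : perm_eq [:: w; v; p; q] [:: r1; r2; r3; r4] ->
    9 <= cdsum N + (#|cn v :&: N| + #|cn p :&: N| + #|cn q :&: N| + (q \in cn p)).*2.
  by rewrite -E; apply: deg8_step mc loc d8 zu Nsub uN erefl.
have stepE w v p q t : perm_eq [:: w; v; p; q] [:: r1; r2; r3; r4] ->
    t = #|cn v :&: N| + #|cn p :&: N| + #|cn q :&: N| ->
    9 <= cdsum N + (t + (q \in cn p)).*2.
  by move=> pe ->; apply: step pe.
have self r : (r \in cn r) = false by rewrite in_cn eqxx.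
have [m1 m2 m3 m4] : [/\ r1 \in R, r2 \in R, r3 \in R & r4 \in R].
  by rewrite !memR !inE !eqxx !orbT.
apply: (@deg8_arith (cdsum N) #|cn r1 :&: N| #|cn r2 :&: N| #|cn r3 :&: N| #|cn r4 :&: N|
  (r2 \in cn r1) (r3 \in cn r1) (r4 \in cn r1) (r3 \in cn r2) (r4 \in cn r2) (r4 \in cn r3)).
- exact: cdsum_even.
- by move: six; rewrite bigR.
- by have := R_le _ m1; rewrite cnR self add0n.
- by have := R_le _ m2; rewrite cnR self /= ?addn0 [r1 \in _]cn_sym.
- by have := R_le _ m3; rewrite cnR self /= ?addn0 [r1 \in _]cn_sym [r2 \in _]cn_sym.
- by have := R_le _ m4; rewrite cnR self /= ?addn0 [r1 \in _]cn_sym [r2 \in _]cn_sym [r3 \in _]cn_sym.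
- by apply: (stepE r1 r4 r2 r3); [apply/permP => a /=; nlia | nlia].
- by apply: (stepE r1 r3 r2 r4); [apply/permP => a /=; nlia | nlia].
- by apply: (stepE r1 r2 r3 r4); [apply/permP => a /=; nlia | nlia].
- by apply: (stepE r2 r4 r1 r3); [apply/permP => a /=; nlia | nlia].
- by apply: (stepE r2 r3 r1 r4); [apply/permP => a /=; nlia | nlia].
- by apply: (stepE r2 r1 r3 r4); [apply/permP => a /=; nlia | nlia].
- by apply: (stepE r3 r4 r1 r2); [apply/permP => a /=; nlia | nlia].
- by apply: (stepE r3 r2 r1 r4); [apply/permP => a /=; nlia | nlia].
- by apply: (stepE r3 r1 r2 r4); [apply/permP => a /=; nlia | nlia].
- by apply: (stepE r4 r3 r1 r2); [apply/permP => a /=; nlia | nlia].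
- by apply: (stepE r4 r2 r1 r3); [apply/permP => a /=; nlia | nlia].
- by apply: (stepE r4 r1 r2 r3); [apply/permP => a /=; nlia | nlia].
Qed.

(** The missing pairs in [nb z] form a matching inside [T], the part seen by [D]. Attaching [D] to
    [M] bounds [T] by four vertices, and [T] separates [K] from the rest. Edge counting over this
    separation leaves two cases, settled by explicit contractions. *)
Lemma attached_deg6 (G : sgraph) (z : G) (D : {set G}) :
  mincex G -> (forall x : G, 6 <= #|nb x|) -> conn D -> [disjoint D & z |: nb z] ->
  nbs D \subset D :|: nb z ->
  (forall w, w \in nb z -> w \notin nbs D -> nb w \subset z |: nb z) ->
  #|nb z| <> 6.
Proof.
move=> mc deg6 cD dD nD hD d6; have n10 := mc_n10 mc; have [_ lo hi _] := mc.
have zz : z \notin nb z by rewrite inE sedge_irr.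
pose M := z |: nb z.
have cM : #|M| = 7 by rewrite card_nbU1 d6.
have hD0 w : w \in nb z -> w \notin nbs D -> cn w :&: nb z = set0.
  by move=> zw wD; apply: cn_nested; rewrite ?hD // d6.
have loc : attached z D by [].
have hle w : w \in nb z -> #|cn w :&: nb z| <= 1.
  by move=> zw; have := cn_le mc zw; rewrite d6; nlia.
pose T := nb z :&: nbs D.
have Tz : T \subset nb z by apply: subsetIl.
have cnT w q : w \in nb z -> q \in cn w -> q \in nb z -> q \in T.
  by move=> zw wq zq; rewrite in_setI zq (attached_nbs loc zw wq).
set S := cdsum (nb z).
have Sev : odd S = false by apply: cdsum_even.
have ST : S = \sum_(w in T) #|cn w :&: nb z|.
  rewrite /S cdsumE (big_setID T) /= (setIidPr Tz) [X in _ + X]big1 ?addn0 //.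
  move=> w /setDP[zw]; rewrite in_setI zw /= => wD.
  by rewrite hD0 // cards0.
have Sle : S <= #|T|.
  by rewrite ST -sum1_card; apply: leq_sum => w /(subsetP Tz); apply: hle.
have cT : cdsum T = S.
  rewrite ST cdsumE; apply: eq_bigr => w wT; apply: eq_card => y.
  rewrite !in_setI; case: (boolP (y \in cn w)) => //= wy.
  case: (boolP (y \in nb z)) => //= zy.
  by have := cnT _ _ (subsetP Tz _ wT) wy zy; rewrite in_setI => /andP[].
have dT := dsum_co T; rewrite cT in dT.
have dM : dsum M + S = 42 by have := dsum_co M; rewrite cM cdsum_closed_nb.
have TDM : nbs D :&: M = T.
  apply/setP => y; rewrite !in_setI in_setU1 [RHS]andbC; case: (eqVneq y z) => //= ->.
  rewrite (negbTE zz) andbF andbT; apply/negP => /(subsetP nD).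
  by rewrite in_setU (negbTE zz) orbF (disjointFl dD) // setU11.
have := mc_attach mc cD dD; rewrite -/M cM TDM => /(_ isT) h.
have win : #|T|.*2 <= S + 5 by move: (h (ltnW n10)) dM; clear; lia.
pose K := M :\: T.
have TM : T \subset M by apply: subset_trans Tz (subsetUr _ _).
have cK : #|K| + #|T| = 7 by rewrite -cM -(cardsID T M) (setIidPr TM) addnC.
have KT : K :|: T = M by rewrite setUC setUD_sub.
have dKT : [disjoint K & T] by rewrite disjoint_sym disjoint_setD.
have Knb x : x \in K -> nb x \subset K :|: T.
  rewrite KT => /setDP[/setU1P[->|zx] xT]; first exact: subsetUr.
  by apply: hD => //; apply: contra xT => xD; rewrite in_setI zx.
have cutE := dsum_cut dKT Knb; rewrite KT in cutE.
have cKC := cardsC K.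
have DK : D :|: T \subset ~: K.
  rewrite subUset -!disjoints_subset [in X in _ && X]disjoint_sym dKT andbT.
  by apply: disjointWr dD; rewrite -/M -KT subsetUl.
have [/set0Pn[x0 x0D] _] := cD.
have nbD x : x \in D -> x |: nb x \subset D :|: T.
  move=> xD; rewrite subUset sub1set in_setU xD /=; apply/subsetP => y xy.
  have yn : y \in nbs D by apply/nbsP; exists x => //; rewrite inE in xy.
  have := subsetP nD _ yn; rewrite !in_setU in_setI yn andbT; by [].
have DT7 : 7 <= #|D :|: T|.
  apply: leq_trans (subset_leq_card (nbD _ x0D)); by rewrite card_nbU1 ltnS.
have KC7 : 7 <= #|~: K| by apply: leq_trans DT7 (subset_leq_card DK).
have KC8 : 8 <= #|~: K| -> dsum (~: K) + 25 <= 9 * #|~: K|.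
  by move=> k8; apply: mc_sub => //; nlia.
have t4 : #|T| <= 4 by nlia.
have KCle := dsum_le (~: K).
(* In all other cases deleting K contradicts minimality. *)
have Kcase : #|T| = 4 /\ S = 4 \/ #|T| = 3 /\ S = 2 /\ #|~: K| = 7.
  case/boolP: (#|~: K| == 7) => [/eqP k7|k7].
    rewrite k7 in KCle cKC *; move: t4 Sle win cutE cK cKC dM dT KCle lo hi Sev; clear.
    by case: #|T| => [|[|[|[|[|]]]]] //=; lia.
  have {}KC8 : dsum (~: K) + 25 <= 9 * #|~: K|.
    by apply: KC8; move: KC7 k7; clear; lia.
  move: t4 Sle win cutE cK cKC dM dT KC8 lo hi Sev; clear.
  by case: #|T| => [|[|[|[|[|]]]]] //=; lia.
have cn1 w : w \in nb z -> 0 < #|cn w :&: nb z| -> exists q, cn w :&: nb z = [set q].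
  by move=> zw w0; apply/cards1P; rewrite eqn_leq hle.
case: Kcase => [[T4 S4]|[T3 [S2 k7]]].
(* [T] is a complete graph on four vertices minus a perfect matching, and [K] consists of [z], [w]
   and [w'], each adjacent to all of [T]. Contracting [z] onto [p] and [w] onto [q] adds both
   missing pairs. *)
- have T1 w : w \in T -> exists q, cn w :&: nb z = [set q].
    move=> wT; have zw := subsetP Tz _ wT; apply: cn1 => //.
    rewrite lt0n; apply/negP => /eqP w0.
    have : S <= \sum_(v in T :\ w) 1.
      rewrite ST (big_setD1 w) //= w0 add0n; apply: leq_sum => v /setD1P[_ vT].
      by apply: hle; apply: (subsetP Tz).
    by rewrite sum1_card; have := cardsD1 w T; rewrite wT; nlia.
  have [p pT] : exists p, p \in T by apply/set0Pn; rewrite -card_gt0 T4.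
  have [p' pp'] := T1 p pT.
  have /set0Pn[q] : T :\ p :\ p' != set0.
    rewrite -card_gt0; have := cardsD1 p T; have := cardsD1 p' (T :\ p).
    by rewrite pT T4; clear; lia.
  move=> /setD1P[qp' /setD1P[qp qT]]; have [q' qq'] := T1 q qT.
  have zK : z \in K by rewrite in_setD setU11 andbT; apply: contra zz; apply: (subsetP Tz).
  have [w wK'] : exists w, w \in K :\ z.
    by apply/set0Pn; rewrite -card_gt0; have := cardsD1 z K; rewrite zK; move: cK T4; clear; lia.
  have [w' wK2] : exists w', w' \in K :\ z :\ w.
    apply/set0Pn; rewrite -card_gt0; have := cardsD1 z K; have := cardsD1 w (K :\ z).
    by rewrite zK wK'; move: cK T4; clear; lia.
  have Kw x : x \in K :\ z -> [/\ x \in K, x \in nb z, x \notin T & forall y, y \in nb z -> y != x -> x -- y].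
    move=> /setD1P[xz xK]; have /setDP[] := xK; rewrite in_setU1 (negbTE xz) /= => zx xT.
    split=> // y zy yx; apply: contraT => xy.
    have : y \in cn x :&: nb z by rewrite in_setI zy in_cn eq_sym yx xy.
    have xD : x \notin nbs D by apply: contra xT => xD; rewrite in_setI zx.
    by rewrite hD0 // in_set0.
  have [wK zw wT wadj] := Kw _ wK'.
  have [w'K zw' w'T w'adj] := Kw _ (subsetP (subsetDl _ _) _ wK2).
  have w'w : w' != w by case/setD1P: wK2.
  have [zp zq] : p \in nb z /\ q \in nb z by split; apply: (subsetP Tz).
  have notK x : x \in T -> x \in ~: K by move=> xT; rewrite inE (disjointFl dKT).
  have sing x x' (V : {set G}) : x \in T -> cn x :&: nb z = [set x'] -> ~: K \subset V ->
      [set x'] \subset V /\ x \notin [set x'].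
    move=> xT xE KV; have : x' \in cn x :&: nb z by rewrite xE set11.
    rewrite in_setI => /andP[xx' zx']; split.
      rewrite sub1set (subsetP KV) // notK // (cnT x) //; exact: (subsetP Tz).
    by rewrite inE; move: xx'; rewrite in_cn => /andP[].
  have r1 (V : {set G}) : ~: K \subset V -> z \notin V -> rooted V p [set p; z] [set p'].
    move=> KV zV; have [? ?] := sing _ _ _ pT pp' KV; split=> //.
    - apply: (connU (conn1 p) (conn1 z) (set11 p) (set11 z)).
      by rewrite sedge_sym; rewrite inE in zp; rewrite zp orbT.
    - apply/setP => y; rewrite in_setI in_set2 in_set1; case: eqVneq => [->|_] /=.
        by rewrite (subsetP KV) ?notK.
      by case: eqVneq => //= ->; rewrite (negbTE zV).
    - move=> y yp; have : y \in cn p :&: nb z by rewrite pp'.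
      rewrite in_setI => /andP[+ zy]; rewrite in_cn => /andP[_ ->]; split=> //.
      by apply/nbsP; exists z; [rewrite !inE eqxx orbT | rewrite inE in zy].
  have r2 (V : {set G}) : ~: K \subset V -> w \notin V -> rooted V q [set q; w] [set q'].
    move=> KV wV; have [? ?] := sing _ _ _ qT qq' KV; split=> //.
    - apply: (connU (conn1 q) (conn1 w) (set11 q) (set11 w)).
      rewrite sedge_sym wadj ?orbT //; by apply: contraNneq wT => <-.
    - apply/setP => y; rewrite in_setI in_set2 in_set1; case: eqVneq => [->|_] /=.
        by rewrite (subsetP KV) ?notK.
      by case: eqVneq => //= ->; rewrite (negbTE wV).
    - move=> y yq; have : y \in cn q :&: nb z by rewrite qq'.
      rewrite in_setI => /andP[qy zy]; split; first by move: qy; rewrite in_cn => /andP[].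
      apply/nbsP; exists w; first by rewrite !inE eqxx orbT.
      apply: wadj => //; apply: contraNneq wT => <-; exact: (cnT q).
  have dZ : [disjoint [set p; z] & [set q; w]].
    rewrite disjointsU1 disjoint_sym disjoints1 !in_set2 !negb_or qp.
    have -> : q != z by apply: contraNneq zz => E; rewrite -{1}E.
    have -> : w != p by apply: contraNneq wT => ->.
    by apply: contraNneq zz => E; rewrite -{1}E.
  have qp1 : q \notin [set p'] by rewrite inE.
  have zC : z \notin ~: K by rewrite inE zK.
  have wC : w \notin ~: K by rewrite inE wK.
  have w'C : w' \notin ~: K by rewrite inE w'K.
  (* If only seven vertices lie outside [K], then [w'] is kept as the eighth. *)
  case/boolP: (#|~: K| == 7) => [/eqP k7|k7].
    have zV : z \notin w' |: ~: K.
      by rewrite in_setU1 negb_or zC andbT; apply: contraNneq zz => E; rewrite {1}E.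
    have wV : w \notin w' |: ~: K by rewrite in_setU1 negb_or eq_sym w'w.
    have := mc_contract2 mc (r1 _ (subsetUr _ _) zV) (r2 _ (subsetUr _ _) wV) dZ qp1.
    rewrite !cards1 cardsU1 w'C k7 dsumU1 // => /(_ isT (ltnW n10)).
    have : #|T| <= #|nb w' :&: ~: K|.
      apply: subset_leq_card; apply/subsetP => x xT; rewrite in_setI notK // andbT inE.
      by rewrite w'adj ?(subsetP Tz) //; apply: contraNneq w'T => <-.
    move: T4 cutE cK cKC dM dT lo S4 k7; clear.
    by case: #|T| => [|[|[|[|[|]]]]] //=; lia.
  have := mc_contract2 mc (r1 _ (subxx _) zC) (r2 _ (subxx _) wC) dZ qp1.
  rewrite !cards1; move: T4 cutE cK cKC dM dT lo S4 KC7 k7; clear.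
  by case: #|T| => [|[|[|[|[|]]]]] //=; lia.
(* [D :|: T] has only seven vertices, so minimum degree 6 makes each vertex of [D] adjacent to all
   others there. Merging one into [p] adds the missing pair, and another is the eighth vertex beside
   [M]: 40 + 2 + 6 = 48. *)
have DTE : D :|: T = ~: K by apply/eqP; rewrite eqEcard DK k7.
have [p pT [q pq]] : exists2 p, p \in T & exists q, cn p :&: nb z = [set q].
  have /existsP[p /andP[pT p0]] : [exists p in T, 0 < #|cn p :&: nb z|].
    apply: contraT => /existsPn n; have : S = 0; last by rewrite S2.
    rewrite ST big1 // => w wT; have := n w; by rewrite wT /= lt0n negbK => /eqP.
  by exists p => //; apply: cn1 => //; apply: (subsetP Tz).
have zp := subsetP Tz _ pT.
have dDT : [disjoint D & T] by apply: disjointWr dD; apply: TM.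
have cD4 : #|D| = 4.
  have : #|D :|: T| = #|D| + #|T| by rewrite -cardsUI (disjoint_setI0 dDT) cards0 addn0.
  by rewrite DTE k7 T3; clear; lia.
have Dadj x y : x \in D -> y \in T -> x -- y.
  move=> xD yT; have := nbD x xD; rewrite DTE => sub.
  have /eqP E : x |: nb x == ~: K by rewrite eqEcard sub k7 card_nbU1 ltnS deg6.
  have : y \in x |: nb x by rewrite E -DTE in_setU yT orbT.
  by rewrite in_setU1 inE => /orP[/eqP yx|//]; rewrite yx (disjointFr dDT xD) in yT.
have /set0Pn[b /setD1P[bx0 bD]] : D :\ x0 != set0.
  by rewrite -card_gt0; have := cardsD1 x0 D; rewrite x0D cD4; clear; lia.
have x0M : x0 \notin M by rewrite (disjointFr dD).
have bM : b \notin M by rewrite (disjointFr dD).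
have : q \in cn p :&: nb z by rewrite pq set11.
rewrite in_setI => /andP[cpq zq]; have qT := cnT _ _ zp cpq zq.
have r : rooted (x0 |: M) p [set p; b] [set q].
  split=> //.
  - apply: (connU (conn1 p) (conn1 b) (set11 p) (set11 b)).
    by rewrite sedge_sym Dadj ?orbT.
  - apply/setP => y; rewrite in_setI in_set2 in_set1; case: eqVneq => [->|_] /=.
      by rewrite !setU1r.
    by case: eqVneq => //= ->; rewrite in_setU1 (negbTE bx0) (negbTE bM).
  - by rewrite sub1set !setU1r.
  - by rewrite inE; move: cpq; rewrite in_cn => /andP[].
  - move=> y /set1P->; split; first by move: cpq; rewrite in_cn => /andP[].
    by apply/nbsP; exists b; [rewrite !inE eqxx orbT | apply: Dadj].
have := mc_contract1 mc r.
rewrite cards1 cardsU1 x0M cM dsumU1 // => /(_ isT (ltnW n10)).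
have : #|T| <= #|nb x0 :&: M|.
  apply: subset_leq_card; apply/subsetP => x xT; rewrite in_setI (subsetP TM) // andbT inE.
  exact: Dadj.
by move: dM S2 T3; clear; lia.
Qed.

(** * A component of least order *)

Lemma component_nb (G : sgraph) (x d c : G) : d \in ~: (x |: nb x) ->
  c \in component (~: (x |: nb x)) d ->
  nb c \subset component (~: (x |: nb x)) d :|: (nb x :&: nbs (component (~: (x |: nb x)) d)).
Proof.
move=> dR; set C := component _ _ => cC; apply/subsetP => y cy.
have yn : y \in nbs C by apply/nbsP; exists c => //; rewrite inE in cy.
rewrite in_setU in_setI yn andbT.
case: (component_nbs dR yn) => [->//|]; rewrite in_setC negbK.
case/setU1P => [yx|->]; last by rewrite orbT.
have := subsetP (component_sub dR) _ cC; rewrite in_setC in_setU1 negb_or.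
by rewrite -yx; move: cy; rewrite !inE sedge_sym => ->; rewrite andbF.
Qed.

Lemma component_disj (G : sgraph) (x d : G) : d \in ~: (x |: nb x) ->
  [disjoint component (~: (x |: nb x)) d & x |: nb x].
Proof. by move=> dR; rewrite disjoints_subset; apply: component_sub. Qed.

(** If all degrees in [C] were at least 9, the degree sum of [C :|: S] would be at least 9|C| +
    5|S|, and the bound 9(|C| + |S|) - 25 gives |S| >= 7. If [S] is all of [nb x], then [C] is
    attached to [x], which has degree 7 or 8; otherwise |S| = 7 and [x] has degree 8. *)
Lemma mc_component_low (G : sgraph) (x d : G) : mincex G -> #|nb x| <= 8 ->
  d \in ~: (x |: nb x) ->
  exists2 z, z \in component (~: (x |: nb x)) d & #|nb z| <= 8.
Proof.
move=> mc x8 dR; have n10 := mc_n10 mc.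
have nbC := component_nb dR; have dC := component_disj dR.
have dd := component_self (~: (x |: nb x)) d; have cC := component_conn (~: (x |: nb x)) d.
set C := component _ _ in nbC dC dd cC *.
set S := nb x :&: nbs C in nbC *.
have Sx : S \subset nb x by apply: subsetIl.
have dCS : [disjoint C & S].
  by apply: disjointWr dC; apply: subset_trans Sx (subsetUr _ _).
apply/exists_inP; apply: contraT => /exists_inPn n.
have C9 c : c \in C -> 9 <= #|nb c| by move=> cC'; rewrite ltnNge n.
have cG1 : #|C :|: S| = #|C| + #|S| by rewrite -cardsUI (disjoint_setI0 dCS) cards0 addn0.
have xG1 : x \notin C :|: S.
  by rewrite in_setU (disjointFl dC) ?setU11 // in_setI inE sedge_irr.
have G1lt : #|C :|: S| < #|G|.
  by have := max_card (mem (x |: (C :|: S))); rewrite cardsU1 xG1.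
have G10 : 10 <= #|C :|: S|.
  apply: leq_trans (_ : #|d |: nb d| <= _); first by rewrite card_nbU1 ltnS C9.
  by apply: subset_leq_card; rewrite subUset sub1set in_setU dd nbC.
have dG1 : dsum (C :|: S) = \sum_(c in C) #|nb c| + \sum_(s in S) #|nb s :&: (C :|: S)|.
  rewrite /dsum big_setU_disj //; congr (_ + _); apply: eq_bigr => c cC'.
  by rewrite (setIidPl (nbC _ cC')).
have sumC : 9 * #|C| <= \sum_(c in C) #|nb c|.
  by rewrite mulnC -sum_nat_const; apply: leq_sum => c /C9.
have nbS s : s \in S -> exists2 b, b \in C & b -- s.
  by case/setIP => _ /nbsP[b bC bs]; exists b.
(* A neighbour [b] of [s] in [C] and the four common neighbours of [b] and [s] all lie in
   [C :|: S]. *)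
have S5 s : s \in S -> 5 <= #|nb s :&: (C :|: S)|.
  move=> sS; have [b bC bs] := nbS s sS.
  apply: leq_trans (_ : #|b |: (nb b :&: nb s)| <= _).
    by rewrite cardsU1 !inE sedge_irr /= ltnS mc_common.
  apply: subset_leq_card; rewrite subUset sub1set in_setI in_setU bC andbT inE sedge_sym bs /=.
  by rewrite setIC setIS // nbC.
have sumS k : (forall s, s \in S -> k <= #|nb s :&: (C :|: S)|) ->
    k * #|S| <= \sum_(s in S) #|nb s :&: (C :|: S)|.
  by move=> h; rewrite mulnC -sum_nat_const; apply: leq_sum.
have h0 := @mc_sub _ (C :|: S) mc (ltnW (ltnW G10)) G1lt.
have S7 : 7 <= #|S|.
  by have := sumS 5 S5; move: h0 dG1 sumC cG1; clear; lia.
have Sle := subset_leq_card Sx.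
have [S7' d8] : #|S| = 7 /\ #|nb x| = 8.
  suff : #|S| != #|nb x| by move: Sle S7 x8; clear; lia.
  apply/negP => /eqP E; have SE : S = nb x by apply/eqP; rewrite eqEcard Sx E leqnn.
  have loc : attached x C.
    by split=> // w; rewrite -SE => /setIP[_ ->].
  have := attached_deg7 mc loc; have := attached_deg8 mc loc.
  by move: S7 x8 E; clear; lia.
(* With |S| = 7 the slack is 28 - 25 = 3. Contracting [x] onto a vertex of [S] with two
   non-neighbours in [S] gains 4; if there is none, each vertex of [S] has five neighbours in [S]
   and one in [C], which gains 7. *)
case: (boolP [exists s in S, 2 <= #|cn s :&: S|]) => [/exists_inP[s sS s2]|/exists_inPn few].
  have xs : x -- s by case/setIP: sS => xs _; rewrite inE in xs.
  have r : rooted (C :|: S) s [set s; x] (cn s :&: S).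
    split.
    - apply: (connU (conn1 s) (conn1 x) (set11 s) (set11 x)).
      by rewrite sedge_sym xs orbT.
    - apply/setP => y; rewrite in_setI in_set2 in_set1; case: eqVneq => [->|_] /=.
        by rewrite in_setU sS orbT.
      by case: eqVneq => //= ->; rewrite (negbTE xG1).
    - by apply: subset_trans (subsetIr _ _) (subsetUr _ _).
    - by rewrite in_setI in_cn eqxx.
    - move=> q /setIP[sq qS]; split; first by move: sq; rewrite in_cn => /andP[].
      apply/nbsP; exists x; first by rewrite !inE eqxx orbT.
      by case/setIP: qS => xq _; rewrite inE in xq.
  have := mc_contract1 mc r (ltnW (ltnW G10)) G1lt.
  by have := sumS 5 S5; move: dG1 sumC cG1 S7' s2; clear; lia.
have S6 s : s \in S -> 6 <= #|nb s :&: (C :|: S)|.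
  move=> sS; have [b bC bs] := nbS s sS; rewrite card_setIU_disj //.
  have := card_nb_cn sS; have := few s sS.
  have : 0 < #|nb s :&: C|.
    by rewrite card_gt0; apply/set0Pn; exists b; rewrite in_setI bC andbT inE sedge_sym.
  by move: S7'; clear; lia.
by have := sumS 6 S6; move: h0 dG1 sumC cG1 S7'; clear; lia.
Qed.

Lemma no_mincex (G : sgraph) : ~ mincex G.
Proof.
move=> mc; have n10 := mc_n10 mc; have [_ _ hi _] := mc.
have deg6 (x : G) : 6 <= #|nb x|.
  by rewrite ltn_neqAle mc_deg5 // andbT eq_sym; apply/eqP; apply: mc_no_deg5.
pose P (p : G * G) := (#|nb p.1| <= 8) && (p.2 \in ~: (p.1 |: nb p.1)).
pose F (p : G * G) := #|component (~: (p.1 |: nb p.1)) p.2|.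
have [p0 Pp0] : exists p, P p.
  have [|x _] := @exists_le_mean G (fun x => #|nb x :&: [set: G]|) [set: G] 8.
    by rewrite cardsT -/(dsum [set: G]); move: hi; clear; lia.
  rewrite setIT => x8.
  have /set0Pn[d dR] : ~: (x |: nb x) != set0.
    rewrite -card_gt0; have := cardsC (x |: nb x); rewrite card_nbU1.
    by move: x8 n10; clear; lia.
  by exists (x, d); rewrite /P x8.
case: (@arg_minnP _ p0 P F Pp0) => -[x d] /andP[/= x8 dR] minF.
have nbC := component_nb dR; have dC := component_disj dR.
have [z0 z0C z08] := mc_component_low mc x8 dR.
have CF : F (x, d) = #|component (~: (x |: nb x)) d| by [].
set C := component _ _ in nbC dC z0C CF.
case: (@arg_minnP _ z0 (mem C) (fun z => #|nb z|) z0C) => z zC minz.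
have zC' : z \in C by [].
have z8 : #|nb z| <= 8 by apply: leq_trans (minz _ z0C) z08.
have xR : x \in ~: (z |: nb z).
  have := disjointFr dC zC'; rewrite in_setC !in_setU1 eq_sym => /norP[/negbTE-> /=].
  by rewrite !inE sedge_sym.
have nbD := component_nb xR; have dD := component_disj xR.
have xD := component_self (~: (z |: nb z)) x; have cD := component_conn (~: (z |: nb z)) x.
have DR := component_sub xR.
have Dcl u v := @component_closed _ (~: (z |: nb z)) x u v.
set D := component _ x in nbD dD xD cD DR Dcl.
(* A neighbour [v] of [w] outside the closed neighbourhood of [z] would lie in a component other
   than [D]. That component avoids [nb x], hence stays inside [C] without [z], against the
   minimality of [C]. *)
have nest w : w \in nb z -> w \notin nbs D -> nb w \subset z |: nb z /\ #|nb z| <= #|nb w|.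
  move=> zw wD.
  have wC : w \in C.
    have := subsetP (nbC z zC') _ zw; rewrite in_setU in_setI => /orP[//|/andP[xw _]].
    by case/nbsP: wD; exists x => //; rewrite inE in xw.
  split; last exact: minz.
  have outD v : v -- w -> v \notin D by move=> vw; apply: contra wD => vD; apply/nbsP; exists v.
  apply/subsetP => v wv; apply: contraT => vN.
  have vw : v -- w by rewrite sedge_sym; rewrite inE in wv.
  have vR : v \in ~: (z |: nb z) by rewrite in_setC.
  have vD := outD v vw.
  have SD y : y \in nb x -> y \in ~: (z |: nb z) -> y \in D.
    by move=> xy yR; apply: Dcl xD xR yR _; rewrite inE in xy.
  have := subsetP (nbC w wC) _ wv; rewrite in_setU in_setI => /orP[vC|/andP[xv _]]; last first.
    by rewrite (SD v xv vR) in vD.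
  pose K := component (~: (z |: nb z)) v.
  have KR : K \subset ~: (z |: nb z) by apply: component_sub.
  have cK : conn K by apply: component_conn.
  have KS y : y \in K -> y \notin nb x.
    move=> yK; apply: contra vD => xy; have yD := SD y xy (subsetP KR _ yK).
    apply: (subsetP (conn_sub cK _ yK yD)); last exact: component_self.
    move=> a b aD aK bK; apply: Dcl => //; exact: (subsetP KR).
  have KC : K \subset C.
    apply: (conn_sub cK _ (component_self _ v) vC) => a b aC aK bK ab.
    have := subsetP (nbC a aC) b; rewrite inE => /(_ ab).
    by rewrite in_setU in_setI (negbTE (KS _ bK)) orbF.
  have : #|K| < #|C|.
    apply: proper_card; apply/properP; split=> //; exists z => //.
    by apply/negP => /(subsetP KR); rewrite in_setC setU11.
  have := minF (z, v); rewrite /P /= z8 vR => /(_ isT); rewrite CF.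
  by rewrite leqNgt => /negbTE->.
have loc : attached z D.
  by split=> // w zw wD; have [? ?] := nest w zw wD; apply: cn_nested.
have := deg6 z; have := attached_deg7 mc loc; have := attached_deg8 mc loc.
suff : #|nb z| <> 6 by move: z8; clear; lia.
apply: (attached_deg6 mc deg6 cD dD) => [|w zw wD]; last by case: (nest w zw wD).
apply/subsetP => y /nbsP[u uD uy].
have := subsetP (nbD u uD) y; rewrite inE => /(_ uy).
by rewrite !in_setU in_setI => /orP[->//|/andP[-> _]]; rewrite orbT.
Qed.

(** * From numbers of edges to degree sums *)

Import GRing.Theory Num.Theory.
Local Open Scope ring_scope.

Theorem theorem1p7 (G : sgraph) (hn : (8 <= #|G|)%N)
    (hedges : 9%:R / 2%:R * #|G|%:R - 12%:R <= #|edges G|%:R :> rat) :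
  has_complete_minus_minor 8 4 G.
Proof.
apply: dense8_has_complete_minus_minor; apply: (mincex_dense8 no_mincex) => //.
apply: leq_trans (_ : (#|edges G|.*2 + 24 <= _)%N); last first.
  by rewrite leq_add2r edges_dsum.
by rewrite -(ler_nat rat) natrD natrM -muln2 natrM; lra.
Qed.
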